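(* Let $I\subsetneq E$ be a monomial ideal of $E=K\langle e_1,\dots,e_n\rangle$ with linear quotients with respect to a degree increasing order $u_1,\dots,u_r$ of $G(I)$, and let $F$ be the graded minimal free resolution of $E/I$, with $F_0=E$ and, for $i>0$, $F_i$ the free $E$-module with homogeneous basis $$\{f(a;u):u\in G(I),\ a\in\mathbb{N}^n,\ \mathrm{supp}(a)\subseteq\mathrm{set}(u),\ |a|=i-1\},\qquad \deg f(a;u)=|a|+\deg u.$$ Suppose that the decomposition function $g:M(I)\to G(I)$ is regular. Then the maps in the resolution $F$ are given by $$d(f(0;u))=(-1)^{\deg(u)}u\qquad\text{for }u\in G(I),$$ and, for $a\in\mathbb{N}^n$, $a\neq0$, $u\in G(I)$ and $\mathrm{supp}(a)\subseteq\mathrm{set}(u)$, $$d(f(a;u))=-\sum_{t\in\mathrm{supp}(a)}(-1)^{\deg(u)}e_t f(a-\varepsilon_t;u)+\sum_{t\in\mathrm{supp}(a)\setminus\mathrm{supp}(u)}(-1)^{\deg(g(e_tu))}\frac{e_tu}{g(e_tu)}f(a-\varepsilon_t;g(e_tu)).$$ (That is, the free modules $F_i$ above with these maps $d$ form a graded minimal free resolution of $E/I$.)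
   Context: $K$ is a field, $E=K\langle e_1,\dots,e_n\rangle$ is the exterior algebra of a $K$-vector space with basis $e_1,\dots,e_n$, standard graded; products are written by juxtaposition and $d$ is $E$-linear (coefficients on the left). For $\mu=\{i_1<\dots<i_d\}\subseteq[n]=\{1,\dots,n\}$, $e_\mu=e_{i_1}\cdots e_{i_d}$; a monomial is any element $\pm e_\mu$, with $\mathrm{supp}(\pm e_\mu)=\mu$. A monomial ideal is an ideal generated by monomials; $G(I)$ is its minimal set of monomial generators. $\mathbb{N}$ is the set of non-negative integers, $\varepsilon_1,\dots,\varepsilon_n$ is the canonical basis of $\mathbb{N}^n$, and for $a\in\mathbb{N}^n$, $|a|=\sum a_i$, $\mathrm{supp}(a)=\{j:a_j\ne0\}$. For an ideal $J$ and a monomial $u$, $J:(u)=\{x\in E:xu\in J\}$. $I$ has linear quotients with respect to an order $u_1,\dots,u_r$ of $G(I)$ if $0:(u_1)$ and $(u_1,\dots,u_{j-1}):(u_j)$, $j=2,\dots,r$, are each generated by a subset of $\{e_1,\dots,e_n\}$. The order is degree increasing if $\deg u_1\le\dots\le\deg u_r$. One sets $\mathrm{set}(u_j)=\{k\in[n]:e_k\in(u_1,\dots,u_{j-1}):(u_j)\}$ for $j\ge2$ and $\mathrm{set}(u_1)=\{k\in[n]:e_k\in0:(u_1)\}=\mathrm{supp}(u_1)$. Decomposition function: let $I_j=(u_1,\dots,u_j)$ and let $M(I)$ be the set of all monomials in $I$. The decomposition function $g:M(I)\to G(I)$ of $I$ is $g(u)=u_j$, where $j$ is the smallest number such that $u\in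 I_j$. It is regular if $\mathrm{set}(g(e_su))\subseteq\mathrm{set}(u)$ for all $u\in G(I)$ and all $s\in\mathrm{set}(u)$ with $s\notin\mathrm{supp}(u)$. Conventions: $f(a;u)=0$ if $\mathrm{supp}(a)\not\subseteq\mathrm{set}(u)$. For monomials $u,v$ with $\mathrm{supp}(v)\subseteq\mathrm{supp}(u)$, $\frac{u}{v}$ denotes the unique monomial $u'$ (sign included) with $u'v=u$. A graded free resolution is minimal if the image of each differential $F_i\to F_{i-1}$, $i\ge1$, lies in $(e_1,\dots,e_n)F_{i-1}$. *)

(* Defs.v *)
From HB Require Import structures.
From mathcomp Require Import all_boot all_order all_algebra all_field.
From mathcomp.multinomials Require Import mpoly.

Set Implicit Arguments.
Unset Strict Implicit.
Unset Printing Implicit Defensive.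

Import GRing.Theory.
Local Open Scope ring_scope.

(* The exterior algebra K<e_1, ..., e_n>, e_1, ..., e_n being indexed by 'I_n:
   an element is the family of its coordinates in the basis of the
   e_A = e_{i_1} ... e_{i_d}, for A = {i_1 < ... < i_d}. *)
Definition exterior (K : fieldType) (n : nat) : Type := {ffun {set 'I_n} -> K^o}.

HB.instance Definition _ (K : fieldType) (n : nat) :=
  Vector.on (exterior K n).

Section ExteriorProduct.
Variables (K : fieldType) (n : nat).
Implicit Types (A B C : {set 'I_n}) (x y z : exterior K n).

Definition ext_basis A : exterior K n := [ffun B => (B == A)%:R].

(* The number of transpositions needed to sort e_A e_B. *)
Definition inversions A B : nat := (\sum_(i in A) \sum_(j in B) (j < i))%N.

Definition ext_basis_mul A B : exterior K n :=
  if [disjoint A & B] then (-1) ^+ inversions A B *: ext_basis (A :|: B) else 0.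

Definition ext_mul x y : exterior K n :=
  \sum_A \sum_B (x A * y B) *: ext_basis_mul A B.

Lemma ext_expand x : x = \sum_A x A *: ext_basis A.
Proof.
apply/ffunP => B; rewrite sum_ffunE (bigD1 B) //= big1 => [|A neqAB].
  by rewrite !ffunE eqxx addr0 [_ *: _]mulr1.
by rewrite !ffunE eq_sym (negPf neqAB) [_ *: _]mulr0.
Qed.

Fact ext_mulDl : left_distributive ext_mul +%R.
Proof.
move=> x y z; rewrite -big_split; apply: eq_bigr => A _ /=.
rewrite -big_split; apply: eq_bigr => B _ /=.
by rewrite ffunE mulrDl scalerDl.
Qed.

Fact ext_mulDr : right_distributive ext_mul +%R.
Proof.
move=> x y z; rewrite -big_split; apply: eq_bigr => A _ /=.
rewrite -big_split; apply: eq_bigr => B _ /=.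
by rewrite ffunE mulrDr scalerDl.
Qed.

Fact ext_mulZl a x y : a *: ext_mul x y = ext_mul (a *: x) y.
Proof.
rewrite scaler_sumr; apply: eq_bigr => A _.
rewrite scaler_sumr; apply: eq_bigr => B _.
by rewrite ffunE scalerA mulrA.
Qed.

Fact ext_mulZr a x y : a *: ext_mul x y = ext_mul x (a *: y).
Proof.
rewrite scaler_sumr; apply: eq_bigr => A _.
rewrite scaler_sumr; apply: eq_bigr => B _.
by rewrite ffunE scalerA [x A * (_ *: _)]mulrCA.
Qed.

Fact ext_mul0l x : ext_mul 0 x = 0.
Proof. by rewrite -[in LHS](scale0r 0) -ext_mulZl scale0r. Qed.

Fact ext_mul0r x : ext_mul x 0 = 0.
Proof. by rewrite -[in LHS](scale0r 0) -ext_mulZr scale0r. Qed.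

Fact ext_mul_suml (J : finType) (F : J -> exterior K n) y :
  ext_mul (\sum_j F j) y = \sum_j ext_mul (F j) y.
Proof.
by apply: (big_morph (ext_mul^~ y)) => [u v|]; rewrite ?ext_mulDl ?ext_mul0l.
Qed.

Fact ext_mul_sumr (J : finType) (F : J -> exterior K n) y :
  ext_mul y (\sum_j F j) = \sum_j ext_mul y (F j).
Proof. by apply: (big_morph (ext_mul y)) => [u v|]; rewrite ?ext_mulDr ?ext_mul0r. Qed.

Lemma ext_mul_basis A B : ext_mul (ext_basis A) (ext_basis B) = ext_basis_mul A B.
Proof.
rewrite /ext_mul (bigD1 A) //= [X in _ + X]big1 => [|C neqCA]; last first.
  by rewrite big1 // => D _; rewrite !ffunE (negPf neqCA) mul0r scale0r.
rewrite (bigD1 B) //= big1 => [|C neqCB].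
  by rewrite !ffunE !eqxx mulr1 scale1r !addr0.
by rewrite !ffunE (negPf neqCB) mulr0 scale0r.
Qed.

Lemma sum_setU A B (F : 'I_n -> nat) : [disjoint A & B] ->
  (\sum_(i in A :|: B) F i = \sum_(i in A) F i + \sum_(i in B) F i)%N.
Proof. by move=> dAB; rewrite -bigU //; apply: eq_bigl => i; rewrite !inE. Qed.

Lemma inversionsUl A B C :
  [disjoint A & B] -> inversions (A :|: B) C = (inversions A C + inversions B C)%N.
Proof. by move=> dAB; rewrite /inversions sum_setU. Qed.

Lemma inversionsUr A B C :
  [disjoint B & C] -> inversions A (B :|: C) = (inversions A B + inversions A C)%N.
Proof.
by move=> dBC; rewrite -big_split; apply: eq_bigr => i _; rewrite sum_setU.
Qed.

Fact ext_mulA_basis A B C :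
  ext_mul (ext_basis A) (ext_basis_mul B C) = ext_mul (ext_basis_mul A B) (ext_basis C).
Proof.
rewrite /ext_basis_mul.
case: (boolP [disjoint B & C]) => dBC; case: (boolP [disjoint A & B]) => dAB;
  rewrite ?ext_mul0l ?ext_mul0r -?ext_mulZr -?ext_mulZl ?ext_mul_basis //.
- rewrite /ext_basis_mul disjoints_subset setCU subsetI -!disjoints_subset dAB /=.
  rewrite [in RHS]disjoints_subset subUset -!disjoints_subset dBC andbT.
  case: ifP => dAC; rewrite ?scaler0 // !scalerA -!exprD setUA.
  by rewrite inversionsUl // inversionsUr // addnCA [(_ B C + _)%N]addnC.
- rewrite /ext_basis_mul disjoints_subset setCU subsetI -!disjoints_subset (negPf dAB).
  by rewrite scaler0.
- rewrite /ext_basis_mul disjoints_subset subUset -!disjoints_subset (negPf dBC).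
  by rewrite andbF scaler0.
Qed.

Fact ext_mulA : associative ext_mul.
Proof.
move=> x y z; rewrite (ext_expand x) ext_mul_suml (ext_mul_suml _ y) ext_mul_suml.
apply: eq_bigr => A _; rewrite -(ext_mulZl _ _ y) -!ext_mulZl; congr (_ *: _).
rewrite (ext_expand y) (ext_mul_suml _ z) !(ext_mul_sumr _ (ext_basis A)).
rewrite ext_mul_suml; apply: eq_bigr => B _.
rewrite -(ext_mulZl _ _ z) -!ext_mulZr -ext_mulZl; congr (_ *: _).
rewrite (ext_expand z) (ext_mul_sumr _ (ext_basis B)) !ext_mul_sumr.
apply: eq_bigr => C _; rewrite -(ext_mulZr _ (ext_basis B)) -!ext_mulZr.
by rewrite !ext_mul_basis ext_mulA_basis.
Qed.

Fact ext_mul1l : left_id (ext_basis set0) ext_mul.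
Proof.
move=> x; rewrite [in LHS](ext_expand x) ext_mul_sumr [RHS](ext_expand x).
apply: eq_bigr => A _; rewrite -ext_mulZr ext_mul_basis /ext_basis_mul.
by rewrite disjoints_subset sub0set set0U /inversions big_set0 expr0 scale1r.
Qed.

Fact ext_mul1r : right_id (ext_basis set0) ext_mul.
Proof.
move=> x; rewrite [in LHS](ext_expand x) ext_mul_suml [RHS](ext_expand x).
apply: eq_bigr => A _; rewrite -ext_mulZl ext_mul_basis /ext_basis_mul.
rewrite disjoint_sym disjoints_subset sub0set setU0 /inversions.
by rewrite big1 ?expr0 ?scale1r // => i _; rewrite big_set0.
Qed.

Fact ext_oner_neq0 : ext_basis set0 != 0.
Proof. by apply/eqP => /ffunP/(_ set0)/eqP; rewrite !ffunE eqxx oner_eq0. Qed.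

HB.instance Definition _ := GRing.Zmodule_isNzRing.Build (exterior K n)
  ext_mulA ext_mul1l ext_mul1r ext_mulDl ext_mulDr ext_oner_neq0.
HB.instance Definition _ := GRing.Lmodule_isLalgebra.Build K (exterior K n) ext_mulZl.
HB.instance Definition _ := GRing.Lalgebra_isAlgebra.Build K (exterior K n) ext_mulZr.
HB.instance Definition _ := Algebra_isFalgebra.Build K (exterior K n).


End ExteriorProduct.

Definition gen (K : fieldType) (n : nat) (i : 'I_n) : exterior K n :=
  ext_basis K [set i].

Lemma gen_sqr (K : fieldType) n (i : 'I_n) : gen K i * gen K i = 0.
Proof.
by rewrite [LHS]ext_mul_basis /ext_basis_mul disjoints_subset sub1set !inE eqxx.
Qed.

Lemma gen_anticomm (K : fieldType) n (i j : 'I_n) : gen K i * gen K j = - (gen K j * gen K i).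
Proof.
have lt_ij (k l : 'I_n) : (k < l)%N -> gen K k * gen K l = - (gen K l * gen K k).
  move=> ltkl; rewrite [X in X = _]ext_mul_basis [X in - X]ext_mul_basis.
  rewrite /ext_basis_mul disjoint_sym disjoints_subset sub1set !inE.
  rewrite -val_eqE gtn_eqF //= /inversions !big_set1 ltkl ltnNge ltnW //=.
  by rewrite scale1r expr1 scaleN1r opprK setUC.
have [/lt_ij //|/lt_ij ->|/val_inj ->] := ltngtP i j; first by rewrite opprK.
by rewrite gen_sqr oppr0.
Qed.

Lemma ext_basisE (K : fieldType) n (A : {set 'I_n}) :
  ext_basis K A = \prod_(i in A) gen K i.
Proof.
suff gen_sorted (s : seq 'I_n) : sorted ltn (map val s) ->
    \prod_(i <- s) gen K i = ext_basis K [set i in s].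
  rewrite -big_filter deprecated_filter_index_enum gen_sorted; first by congr ext_basis; apply/setP => i; rewrite inE mem_enum.
  rewrite (@sorted_map _ _ val) {1}/enum_mem.
  apply: sorted_filter; first by move=> i j k; apply: ltn_trans.
  by rewrite -(@sorted_map _ _ val) -enumT val_enum_ord iota_ltn_sorted.
elim: s => [_|i s IHs lt_is]; first by rewrite big_nil; congr ext_basis; apply/setP => i; rewrite !inE.
rewrite big_cons IHs ?(path_sorted lt_is) // [LHS]ext_mul_basis /ext_basis_mul.
have lt_ij (j : 'I_n) : j \in s -> (i < j)%N.
  move=> js; have /allP := order_path_min ltn_trans lt_is.
  by apply; apply: map_f.
rewrite disjoints_subset sub1set !inE ifT; last first.
  by apply/negP => /lt_ij; rewrite ltnn.
rewrite /inversions big_set1 big1 ?expr0 ?scale1r; last first.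
  by move=> j; rewrite inE => /lt_ij ltij; rewrite ltnNge ltnW.
by congr ext_basis; apply/setP => j; rewrite !inE.
Qed.

Section LinearQuotients.
Variables (K : fieldType) (n : nat).
Local Notation E := (exterior K n).
Implicit Types (I J : {vspace E}) (us vs : seq E) (u v x : E) (k : 'I_n).

Definition signed_monomial (p : bool * {set 'I_n}) : E :=
  (-1) ^+ p.1 * \prod_(i in p.2) gen K i.

Definition is_monomial x : bool := [exists p, x == signed_monomial p].

Definition esupp x : {set 'I_n} := \bigcup_(A | x A != 0) A.
Definition edeg x : nat := #|esupp x|.

(* u / v, the monomial w with w * v = u; junk value 0 if there is none. *)
Definition monomial_div u v : E :=
  if [pick p | signed_monomial p * v == u] is Some p then signed_monomial p else 0.

(* The two-sided ideal generated by vs. *)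
Definition ideal vs : {vspace E} := (fullv * <<vs>> * fullv)%VS.

Definition colon J u : {vspace E} := (amulr u @^-1: J)%VS.

Lemma mem_colon J u x : (x \in colon J u) = (x * u \in J).
Proof. by rewrite -memv_preim lfunE. Qed.

(* us lists G(I) without repetition; in particular I is a monomial ideal. *)
Definition minimal_monomial_generators I us : Prop :=
  [/\ all is_monomial us, uniq us, ideal us = I
    & forall vs, {subset vs <= us} -> ideal vs = I -> {subset us <= vs}].

(* For j = 0 the colon ideal is 0 : (u_1), since ideal [::] = 0. *)
Definition linear_quotients us : Prop :=
  forall j, (j < size us)%N -> exists S : {set 'I_n},
    colon (ideal (take j us)) us`_j = ideal [seq gen K k | k <- enum S].

Definition degree_increasing us : bool := sorted leq (map edeg us).

Definition qset us u : {set 'I_n} :=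
  [set k | gen K k \in colon (ideal (take (index u us) us)) u].

Definition decomposition us x : E :=
  us`_(find (fun j => x \in ideal (take j.+1 us)) (iota 0 (size us))).

Definition regular_decomposition us : Prop :=
  forall u k, u \in us -> k \in qset us u -> k \notin esupp u ->
    qset us (decomposition us (gen K k * u)) \subset qset us u.

Definition expsupp (a : 'X_{1..n}) : {set 'I_n} := [set k | a k != 0%N].

(* The pairs (a, u) with u in G(I), |a| = j and supp(a) a subset of set(u). *)
Definition res_index us (j : nat) : finType :=
  {p : 'X_{1..n < j.+1} * seq_sub us
     | (mdeg p.1 == j) && (expsupp p.1 \subset qset us (ssval p.2))}.

Definition res_deg us j (b : res_index us j) : nat :=
  mdeg (val b).1 + edeg (ssval (val b).2).

Definition res_module us (i : nat) : lmodType E :=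
  if i is j.+1 then {ffun res_index us j -> E^o} else E^o.

(* f(a; u), as an element of F_(j+1); it is 0 unless |a| = j, u is in us and
   supp(a) is a subset of set(u). *)
Definition res_basis us j (a : 'X_{1..n}) u : res_module us j.+1 :=
  [ffun b : res_index us j =>
     ((bmnm (val b).1 == a) && (ssval (val b).2 == u))%:R : E^o].

Lemma res_basis_expand us j (x : res_module us j.+1) :
  x = \sum_(b : res_index us j)
        (x : {ffun res_index us j -> E}) b *: res_basis us j (val b).1 (ssval (val b).2).
Proof.
apply/ffunP => c; rewrite sum_ffunE (bigD1 c) //= big1 => [|b nbc].
  by rewrite !ffunE /= !eqxx addr0 [LHS](esym (mulr1 _)).
rewrite !ffunE /=; case: eqP => [e1|_]; case: eqP => [e2|_] /=; try by rewrite [LHS]mulr0.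
case/negP: nbc; apply/eqP/esym/val_inj.
by rewrite [LHS]surjective_pairing [RHS]surjective_pairing; congr pair; apply/val_inj.
Qed.

Definition homogeneous (p : nat) x : bool := [forall A, (x A != 0) ==> (#|A| == p)].

Definition res_homogeneous us i (p : nat) : res_module us i -> Prop :=
  match i with
  | 0 => fun x : E => homogeneous p x
  | j.+1 => fun x : {ffun res_index us j -> E} =>
      forall b, x b != 0 -> exists2 q, homogeneous q (x b) & (q + res_deg b)%N = p
  end.

(* The submodule J V of V. *)
Definition in_ideal_mul J (V : lmodType E) (y : V) : Prop :=
  exists2 s : seq (E * V), all (fun p => p.1 \in J) s & y = \sum_(p <- s) p.1 *: p.2.

(* The free modules F_i with the maps d i : F_(i+1) -> F_i, augmented by the
   projection of F_0 = E onto E / I, whose kernel is I. *)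
Record graded_minimal_resolution I us
    (d : forall i, {linear res_module us i.+1 -> res_module us i}) : Prop := {
  res_exact0 : forall x : res_module us 0, (x : E) \in I <-> exists y, d 0%N y = x;
  res_exact : forall i (x : res_module us i.+1), d i x = 0 <-> exists y, d i.+1 y = x;
  res_graded : forall i p (x : res_module us i.+1),
    res_homogeneous p x -> res_homogeneous p (d i x);
  res_minimal : forall i (x : res_module us i.+1),
    in_ideal_mul (ideal [seq gen K k | k <- enum 'I_n]) (d i x) }.

End LinearQuotients.

(* Main.v *)
(* Order [F] by the position of [u] in [us]. Regularity makes the span of the [f(a; u_k)],
   [k <= m], a subcomplex, because [g(e_t u)] precedes [u] for [t] in set(u) outside supp(u),
   and modulo the previous one it is a Cartan complex on the variables in set([u_m]). The
   Cartan complex is acyclic and resolves E / (e_k, k in set(u_m)), which is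
   E / ((u_1, ..., u_(m-1)) : u_m) by linear quotients; so a cycle can be pushed down, one
   top index at a time, by adding boundaries.

   For [d^2 = 0], let [w = g(e_t u)]. Then [c w = e_t u] with supp(c) disjoint from set(w),
   and regularity gives [g(e_s w) = g(e_s e_t u)] for [s] in set(w), while [s] outside set(w)
   gives [w = g(e_s e_t u)]. In both cases the remaining contribution of the pair (t, s) is a
   multiple of [f(a - U_(s) - U_(t); z)] with [z = g(e_s e_t u)], whose coefficient times [z]
   is [e_s e_t u] up to a sign that does not depend on (t, s); it therefore cancels with the
   contribution of (s, t). *)

Require Import Defs.
From HB Require Import structures.
From mathcomp Require Import all_boot all_order all_algebra all_field.
From mathcomp.multinomials Require Import mpoly.

Set Implicit Arguments.
Unset Strict Implicit.
Unset Printing Implicit Defensive.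

Import GRing.Theory.
Local Open Scope ring_scope.

(** * Monomials and monomial ideals *)

Section Monomials.
Variables (K : fieldType) (n : nat).
Local Notation E := (exterior K n).
Implicit Types (A B C D : {set 'I_n}) (x y u v : E) (t : 'I_n).

Lemma mul_basisE A B : ext_basis K A * ext_basis K B = ext_basis_mul K A B.
Proof. exact: ext_mul_basis. Qed.

Lemma coefZ_basis (c : K) A B : (c *: ext_basis K A) B = if B == A then c else 0.
Proof. by rewrite !ffunE; case: ifP => _; rewrite ?[LHS]mulr1 ?[LHS]mulr0. Qed.

Lemma coefM_basis A B C :
  (ext_basis K A * ext_basis K B) C =
  if [disjoint A & B] && (C == A :|: B) then (-1) ^+ inversions A B else 0.
Proof.
rewrite mul_basisE /ext_basis_mul; case: ifP => _; last by rewrite ffunE.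
by rewrite coefZ_basis.
Qed.

Lemma coefM x y C :
  (x * y) C = \sum_A \sum_B x A * y B * (ext_basis K A * ext_basis K B) C.
Proof.
rewrite {1}/GRing.mul /= /ext_mul sum_ffunE; apply: eq_bigr => A _.
rewrite sum_ffunE; apply: eq_bigr => B _.
by rewrite ffunE mul_basisE.
Qed.

(** Only the coordinate at [A :\ t] reaches [A] under right multiplication by [e_t]. The Cartan
    homotopy is verified coordinate by coordinate through this formula. *)
Lemma coefM_gen x t A :
  (x * gen K t) A =
  if t \in A then (-1) ^+ inversions (A :\ t) [set t] * x (A :\ t) else 0.
Proof.
have zero B : B != [set t] -> forall D,
    x D * gen K t B * (ext_basis K D * ext_basis K B) A = 0.
  by move=> neB D; rewrite ffunE (negPf neB) mulr0 mul0r.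
have one D : \sum_B x D * gen K t B * (ext_basis K D * ext_basis K B) A
    = x D * (ext_basis K D * ext_basis K [set t]) A.
  rewrite (bigD1 [set t]) //= big1 => [|B neB]; last exact: zero.
  by rewrite ffunE eqxx mulr1 addr0.
rewrite coefM; under eq_bigr => D _ do rewrite one coefM_basis.
have dD D : [disjoint D & [set t]] = (t \notin D).
  by rewrite disjoint_sym disjoints_subset sub1set inE.
case: ifP => tA.
  rewrite (bigD1 (A :\ t)) //= big1 => [|D neD].
    by rewrite dD !inE eqxx /= setUC setD1K // eqxx addr0 mulrC.
  case: ifP => [/andP[]|]; last by rewrite mulr0.
  rewrite dD => tD /eqP eA; case/eqP: neD; rewrite eA.
  by rewrite setUC setU1K.
rewrite big1 // => D _; case: ifP => [/andP[_ /eqP eA]|]; last by rewrite mulr0.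
by rewrite eA !inE eqxx orbT in tA.
Qed.

(** Scalar multiples of [e_A], with 0 allowed: unlike [is_monomial], this is stable under sums and
    under products that vanish. *)
Definition monomial_on A x : Prop := x = x A *: ext_basis K A.

Lemma monomial_onZ A (c : K) : monomial_on A (c *: ext_basis K A).
Proof. by rewrite /monomial_on coefZ_basis eqxx. Qed.

Lemma monomial_on_gen t : monomial_on [set t] (gen K t).
Proof. by rewrite -[gen K t]scale1r; apply: monomial_onZ. Qed.

Lemma coefM_monomial A B x y : monomial_on A x -> monomial_on B y ->
  x * y = if [disjoint A & B]
          then ((-1) ^+ inversions A B * x A * y B) *: ext_basis K (A :|: B) else 0.
Proof.
move=> -> ->; rewrite -scalerAr -scalerAl mul_basisE.
rewrite /ext_basis_mul !coefZ_basis !eqxx; case: ifP => _; last by rewrite !scaler0.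
by rewrite !scalerA mulrC [X in _ * X]mulrC mulrA.
Qed.

Lemma monomial_onM A B x y : monomial_on A x -> monomial_on B y ->
  monomial_on (A :|: B) (x * y).
Proof.
move=> mx my; rewrite (coefM_monomial mx my); case: ifP => _.
  exact: monomial_onZ.
by rewrite /monomial_on ffunE scale0r.
Qed.

(** This allows coefficients to be compared after multiplication by a generator, so that the sign
    chosen by [monomial_div] never has to be computed. *)
Lemma mul_monomial_inj A B x y : monomial_on A x -> monomial_on B y ->
  [disjoint A & B] -> y B != 0 -> x * y = 0 -> x = 0.
Proof.
move=> mx my dAB yB; rewrite (coefM_monomial mx my) dAB => /ffunP/(_ (A :|: B)).
rewrite coefZ_basis eqxx ffunE => /eqP.
rewrite !mulf_eq0 signr_eq0 (negPf yB) orbF /= => /eqP xA.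
by rewrite mx xA scale0r.
Qed.

Lemma mul_monomial_eq0 A B x y : monomial_on A x -> monomial_on B y ->
  ~~ [disjoint A & B] -> x * y = 0.
Proof. by move=> mx my /negPf dAB; rewrite (coefM_monomial mx my) dAB. Qed.

Lemma monomial_onN A x : monomial_on A x -> monomial_on A (- x).
Proof. by move=> mx; rewrite /monomial_on ffunE scaleNr -mx. Qed.

Lemma monomial_onD A x y : monomial_on A x -> monomial_on A y -> monomial_on A (x + y).
Proof. by move=> mx my; rewrite /monomial_on ffunE scalerDl -mx -my. Qed.

Lemma signM_scale k x : (-1) ^+ k * x = (-1) ^+ k *: x.
Proof. by rewrite -(signr_odd E) mulr_sign -(signr_odd K) scaler_sign. Qed.

Lemma monomial_on_sign A x k : monomial_on A x -> monomial_on A ((-1) ^+ k * x).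
Proof.
by move=> mx; rewrite signM_scale /monomial_on ffunE -scalerA -mx.
Qed.

(** For [t] in [A] both products are 0. Otherwise each element of [A] is an inversion with [t] in
    exactly one of the two orders, so the two inversion numbers add up to [#|A|]. *)
Lemma gen_monomial_sign A x t : monomial_on A x ->
  x * gen K t = (-1) ^+ #|A| * (gen K t * x).
Proof.
move=> mx; have mt := monomial_on_gen t.
case: (boolP (t \in A)) => tA.
  rewrite (mul_monomial_eq0 mx mt) ?(mul_monomial_eq0 mt mx) ?mulr0 //.
    by rewrite disjoints_subset sub1set inE tA.
  by rewrite disjoint_sym disjoints_subset sub1set inE tA.
rewrite (coefM_monomial mx mt) (coefM_monomial mt mx) disjoint_sym.
rewrite disjoints_subset sub1set inE tA signM_scale scalerA.
have inv : (inversions A [set t] + inversions [set t] A = #|A|)%N.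
  rewrite /inversions big_set1 -sum1_card -big_split; apply: eq_bigr => i iA /=.
  rewrite big_set1; case: ltngtP => //; move/val_inj => it.
  by rewrite it iA in tA.
have -> : (-1) ^+ inversions A [set t] = (-1) ^+ #|A| * (-1) ^+ inversions [set t] A :> K.
  by rewrite -inv -exprD -addnA exprD addnn -muln2 exprM sqrr_sign mulr1.
by rewrite setUC !mulrA; congr (_ *: _); rewrite mulrAC.
Qed.

Lemma monomialP u : is_monomial u ->
  exists (b : bool) (A : {set 'I_n}), u = (-1) ^+ b *: ext_basis K A.
Proof.
case/existsP => -[b A] /eqP ->; exists b, A.
by rewrite /signed_monomial /= -ext_basisE !mulr_sign scaler_sign; case: b.
Qed.

Lemma signed_monomialE (p : bool * {set 'I_n}) :
  signed_monomial K p = (-1) ^+ p.1 *: ext_basis K p.2.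
Proof. by rewrite /signed_monomial -ext_basisE mulr_sign scaler_sign. Qed.

Lemma is_monomialZ (b : bool) A : is_monomial ((-1) ^+ b *: ext_basis K A).
Proof. by apply/existsP; exists (b, A); rewrite signed_monomialE. Qed.

Lemma esuppZ (c : K) A : c != 0 -> esupp (c *: ext_basis K A) = A.
Proof.
move=> c0; rewrite /esupp (big_pred1 A) // => B.
by rewrite coefZ_basis /=; case: (B == A); rewrite ?c0 ?eqxx.
Qed.

Lemma monomial_on_esupp u : is_monomial u -> monomial_on (esupp u) u.
Proof.
case/monomialP => b [A ->]; rewrite esuppZ ?signr_eq0 //; exact: monomial_onZ.
Qed.

Lemma monomial_coef_neq0 u : is_monomial u -> u (esupp u) != 0.
Proof.
case/monomialP => b [A ->]; rewrite esuppZ ?signr_eq0 // coefZ_basis eqxx.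
by rewrite signr_eq0.
Qed.

Lemma monomial_neq0 u : is_monomial u -> u != 0.
Proof.
by move=> /monomial_coef_neq0; apply: contra_neq => ->; rewrite ffunE.
Qed.

Lemma is_monomial_basis A : is_monomial (ext_basis K A).
Proof. by rewrite -[ext_basis K A]scale1r; apply: (is_monomialZ false). Qed.

Lemma esupp_basis A : esupp (ext_basis K A) = A.
Proof. by rewrite -[ext_basis K A]scale1r esuppZ ?oner_eq0. Qed.

Lemma is_monomial_gen t : is_monomial (gen K t).
Proof. exact: is_monomial_basis. Qed.

Lemma esupp_gen t : esupp (gen K t) = [set t].
Proof. exact: esupp_basis. Qed.

Lemma is_monomialM u v : is_monomial u -> is_monomial v ->
  [disjoint esupp u & esupp v] ->
  is_monomial (u * v) /\ esupp (u * v) = esupp u :|: esupp v.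
Proof.
move=> /monomialP[b [A ->]] /monomialP[c [B ->]]; rewrite !esuppZ ?signr_eq0 // => dAB.
suff -> : (-1) ^+ b *: ext_basis K A * ((-1) ^+ c *: ext_basis K B) =
   (-1) ^+ odd (b + c + inversions A B) *: ext_basis K (A :|: B).
  by rewrite esuppZ ?signr_eq0 //; split=> //; apply: is_monomialZ.
rewrite -scalerAr -scalerAl mul_basisE /ext_basis_mul dAB.
by rewrite !scalerA signr_odd !exprD [X in X * _]mulrC.
Qed.

Lemma is_monomial_genM t u : is_monomial u -> t \notin esupp u ->
  is_monomial (gen K t * u) /\ esupp (gen K t * u) = t |: esupp u.
Proof.
move=> mu tu; have := is_monomialM (is_monomial_gen t) mu.
by rewrite esupp_gen disjoints_subset sub1set inE; apply.
Qed.

Lemma gen_mul_eq0 t u : is_monomial u -> t \in esupp u -> gen K t * u = 0.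
Proof.
move=> mu tu; apply: (mul_monomial_eq0 (monomial_on_gen t) (monomial_on_esupp mu)).
by rewrite disjoints_subset sub1set inE tu.
Qed.

Lemma gen_mul_monomial_eq0 t A x : monomial_on A x -> t \in A -> gen K t * x = 0.
Proof.
move=> mx tA; apply: (mul_monomial_eq0 (monomial_on_gen t) mx).
by rewrite disjoints_subset sub1set inE tA.
Qed.

Lemma monomial_divP u v : is_monomial u -> is_monomial v -> esupp v \subset esupp u ->
  monomial_div u v * v = u /\ monomial_on (esupp u :\: esupp v) (monomial_div u v).
Proof.
move=> mu mv svu.
have [b [B eu]] := monomialP mu; have [c [C ev]] := monomialP mv.
have [sB sC] : esupp u = B /\ esupp v = C by rewrite eu ev !esuppZ ?signr_eq0.
rewrite /monomial_div; case: pickP => [p /eqP pv|noq].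
  split=> //; rewrite signed_monomialE sB sC.
  have -> : p.2 = B :\: C; last exact: monomial_onZ.
  have mp : is_monomial (signed_monomial K p) by rewrite signed_monomialE is_monomialZ.
  have sp : esupp (signed_monomial K p) = p.2 by rewrite signed_monomialE esuppZ ?signr_eq0.
  (* Overlapping supports would make the product 0, whereas [u] is nonzero. *)
  have dp : [disjoint p.2 & C].
    apply/negPn/negP => ndp; have := monomial_neq0 mu; rewrite -pv.
    rewrite (mul_monomial_eq0 (monomial_on_esupp mp) (monomial_on_esupp mv)) ?eqxx //.
    by rewrite sp sC.
  have [|_] := is_monomialM mp mv; rewrite sp sC // pv sB => ->.
  by rewrite setDUl setDv setU0; apply/esym/setDidPl.
rewrite sB sC in svu.
have dBC : [disjoint B :\: C & C] by rewrite disjoints_subset setDE subsetIr.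
(* An explicit quotient contradicts the failure of the search: its sign collects those of [u] and
   [v] and that of sorting the product. *)
have := noq (odd (b + c + inversions (B :\: C) C), B :\: C).
rewrite signed_monomialE /= ev eu -scalerAr -scalerAl mul_basisE.
rewrite /ext_basis_mul dBC !scalerA setUC setDE setUIr setUCr setIT (setUidPr svu).
rewrite signr_odd -!exprD => /negP[]; apply/eqP; congr (_ *: _).
rewrite -[LHS]signr_odd -[RHS]signr_odd !oddD !oddb.
by case: b {eu}; case: c {ev}; case: (odd _).
Qed.

End Monomials.

(** * Membership in monomial ideals, read on coordinates *)

Section MonomialIdeals.
Variables (K : fieldType) (n : nat).
Local Notation E := (exterior K n).
Implicit Types (A B C D : {set 'I_n}) (x y u v : E) (t : 'I_n) (vs : seq E).

Definition mask_coef (P : pred {set 'I_n}) (x : E) : E := [ffun A => if P A then 0 else x A].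

Fact mask_coef_linear P : linear (mask_coef P).
Proof.
move=> c x y; apply/ffunP => A; rewrite !ffunE.
by case: ifP => _; rewrite ?[_ *: 0]mulr0 ?addr0.
Qed.

HB.instance Definition _ P := GRing.isLinear.Build K E E _ (mask_coef P) (mask_coef_linear P).

(** The span of the [e_A] with [P A], presented as a kernel so that membership is a condition on
    coordinates. *)
Definition coord_space (P : pred {set 'I_n}) : {vspace E} := lker (linfun (mask_coef P)).

Lemma coord_spaceP (P : pred {set 'I_n}) x :
  reflect (forall A, x A != 0 -> P A) (x \in coord_space P).
Proof.
rewrite memv_ker lfunE /=; apply: (iffP eqP) => [k0 A | xP].
  by apply: contraR => /negPf nPA; have := congr1 (fun f : E => f A) k0; rewrite !ffunE nPA => ->.
apply/ffunP => A; rewrite !ffunE; case: ifP => // nPA.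
by apply/eqP/negPn/negP => /xP; rewrite nPA.
Qed.

Lemma coefM_neq0 x y C : (x * y) C != 0 ->
  exists A B, [/\ x A != 0, y B != 0, [disjoint A & B] & C = A :|: B].
Proof.
move=> xyC; suff: [exists A, exists B, [&& x A != 0, y B != 0, [disjoint A & B] & C == A :|: B]].
  by case/existsP=> A /existsP[B /and4P[? ? ? /eqP ?]]; exists A, B; split.
apply: contraR xyC => /existsPn nAB; rewrite coefM big1 // => A _; rewrite big1 // => B _.
have /existsPn/(_ B) := nAB A; rewrite coefM_basis.
have [->|xA /=] := eqVneq (x A) 0; first by rewrite !mul0r.
have [->|yB /=] := eqVneq (y B) 0; first by rewrite mulr0 mul0r.
by move/negPf->; rewrite mulr0.
Qed.

Definition divisible vs A : bool := has (fun v => esupp v \subset A) vs.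

Lemma divisibleS vs A B : A \subset B -> divisible vs A -> divisible vs B.
Proof. by move=> sAB; apply: sub_has => v /subset_trans; apply. Qed.

(** The span of the [e_A] divisible by a generator contains the generators and is stable under
    multiplication on both sides, because divisibility passes to larger sets. Conversely such an
    [e_A] is a left multiple of a generator. *)
Lemma ideal_monomialP vs x : all (@is_monomial K n) vs ->
  reflect (forall A, x A != 0 -> divisible vs A) (x \in ideal vs).
Proof.
move=> /allP mvs; apply: (iffP idP) => [xI | xP].
  apply/coord_spaceP; apply: (subvP _) xI; apply/prodvP => y z yI _.
  have {}yI : y \in coord_space (divisible vs).
    apply: (subvP _) yI; apply/prodvP => a b _ bI.
    have {bI} /coord_spaceP bI : b \in coord_space (divisible vs).
      apply: (subvP _) bI; apply/span_subvP => v vvs; apply/coord_spaceP => A vA.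
      apply/hasP; exists v => //.
      have := monomial_on_esupp (mvs v vvs) => e; rewrite e coefZ_basis in vA.
      by move: vA; case: (A =P esupp v) => [->|_]; rewrite ?eqxx.
    apply/coord_spaceP => C /coefM_neq0[A [B [_ /bI dB _ ->]]].
    exact: divisibleS (subsetUr _ _) dB.
  apply/coord_spaceP => C /coefM_neq0[A [B [yA _ _ ->]]].
  by move/coord_spaceP: yI => /(_ A yA); apply/divisibleS/subsetUl.
rewrite (ext_expand x) memv_suml // => A _.
have [->|xA] := eqVneq (x A) 0; first by rewrite scale0r mem0v.
apply: memvZ; have /hasP[v vvs svA] := xP A xA.
have mA := is_monomial_basis K A; have sA := esupp_basis K A.
have [|<- _] := monomial_divP mA (mvs v vvs); first by rewrite sA.
rewrite -[_ * v]mulr1.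
by rewrite memv_mul ?memvf // memv_mul ?memvf // memv_span.
Qed.

Lemma all_gen (s : seq 'I_n) : all (@is_monomial K n) [seq gen K k | k <- s].
Proof. by apply/allP => _ /mapP[k _ ->]; apply: is_monomial_gen. Qed.

Lemma divisible_gen (S A : {set 'I_n}) :
  divisible [seq gen K k | k <- enum S] A = ~~ [disjoint S & A].
Proof.
apply/hasP/pred0Pn => [[_ /mapP[k kS ->]] | [k /andP[kS kA]]].
  by rewrite esupp_gen sub1set => kA; exists k; rewrite /= kA -mem_enum kS.
exists (gen K k); last by rewrite esupp_gen sub1set.
by apply: map_f; rewrite mem_enum.
Qed.

Lemma ideal_genP (S : {set 'I_n}) x :
  reflect (forall A, x A != 0 -> ~~ [disjoint S & A])
    (x \in ideal [seq gen K k | k <- enum S]).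
Proof.
apply: (iffP (ideal_monomialP _ (all_gen _))) => xS A /xS; by rewrite divisible_gen.
Qed.

Lemma mem_ideal vs v : v \in vs -> v \in ideal vs.
Proof.
move=> vvs; rewrite -[v]mul1r -[1 * v]mulr1.
by rewrite memv_mul ?memvf // memv_mul ?memvf // memv_span.
Qed.

Lemma ideal_mull vs x y : y \in ideal vs -> x * y \in ideal vs.
Proof.
move=> yI; have := memv_mul (memvf x) yI; rewrite /ideal !prodvA.
have -> : (fullv * fullv = fullv :> {vspace E})%VS.
  by apply/eqP; rewrite eqEsubv subvf -{1}[fullv%VS]prodv1 prodvSr ?sub1v //; apply: subvf.
by [].
Qed.

End MonomialIdeals.

(** * The sets set(u) and the decomposition function *)

Lemma find_leq_iota k m : (k <= m)%N -> find (leq k) (iota 0 m) = k.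
Proof.
move=> lekm; rewrite -(subnKC lekm) iotaD find_cat ifN; last first.
  by apply/hasPn => i; rewrite mem_iota -ltnNge.
rewrite size_iota; case: (m - k)%N => [|d] /=; first by rewrite addn0.
by rewrite leqnn addn0.
Qed.

(** In use, [x] and [y] are the coefficients of two successive steps, [e] is the second variable and
    [v] is [e_t u]. *)
Lemma mulr_swap (K : fieldType) n (x y z w e v : exterior K n) (a b c : K) :
  y * z = a *: (e * w) -> x * e = b *: (e * x) -> x * w = c *: v ->
  x * y * z = (a * b * c) *: (e * v).
Proof.
move=> yz xe xw; rewrite -[x * y * z]mulrA yz -scalerAr mulrA xe -scalerAl -[e * x * w]mulrA xw.
by rewrite -scalerAr !scalerA.
Qed.

Lemma mulr_anti (K : fieldType) n (x y z u : exterior K n) (c : K) (s t : 'I_n) :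
  x * z = c *: (gen K s * (gen K t * u)) -> y * z = c *: (gen K t * (gen K s * u)) ->
  (x + y) * z = 0.
Proof.
move=> xz yz; rewrite mulrDl xz yz -scalerDr !mulrA -mulrDl gen_anticomm addNr.
by rewrite mul0r scaler0.
Qed.

Section LinearQuotientSets.
Variables (K : fieldType) (n : nat) (us : seq (exterior K n)).
Hypotheses (mon_us : all (@is_monomial K n) us) (uniq_us : uniq us).
Hypothesis lq_us : linear_quotients us.
Local Notation E := (exterior K n).
Implicit Types (A B : {set 'I_n}) (x u v w : E) (s t k : 'I_n).

(** The decomposition function read on supports: whether a monomial lies in a monomial ideal depends
    on its support alone, so signs disappear here. *)
Definition first_index A : nat := find (fun u => esupp u \subset A) us.
Definition first_divisor A : E := us`_(first_index A).

Lemma mem_ideal_take j x : is_monomial x -> (j <= size us)%N ->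
  (x \in ideal (take j us)) = (first_index (esupp x) < j)%N.
Proof.
move=> mx lej; rewrite -has_take_leq //.
have mon_take : all (@is_monomial K n) (take j us).
  by apply/allP => u /mem_take; apply/allP.
apply/(ideal_monomialP _ mon_take)/idP => [| dx A].
  by apply; apply: monomial_coef_neq0.
rewrite (monomial_on_esupp mx) coefZ_basis.
by case: (A =P esupp x) => [->|_]; rewrite ?eqxx.
Qed.

(** The first [j + 1] generators generate [x] exactly when [first_index] is at most [j], so both
    searches stop at the same place; outside I both give the default value 0. *)
Lemma decompositionE x : is_monomial x -> decomposition us x = first_divisor (esupp x).
Proof.
move=> mx; rewrite /decomposition /first_divisor; congr (us`_ _).
rewrite -[RHS](@find_leq_iota _ (size us)) ?find_size //.
have : {subset iota 0 (size us) <= [pred j | j < size us]%N}.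
  by move=> j; rewrite mem_iota.
elim: (iota 0 _) => //= j s IHs sub; rewrite mem_ideal_take ?ltnS //; last first.
  by apply: (sub j); rewrite mem_head.
by rewrite IHs // => i si; apply: sub; rewrite inE si orbT.
Qed.

(** Linear quotients provide some set [S] of variables generating the colon ideal; it must be
    set(u), since [e_k] lies in the ideal generated by the variables of [S] only for [k] in [S]. *)
Lemma colon_qset u : u \in us ->
  colon (ideal (take (index u us) us)) u = ideal [seq gen K k | k <- enum (qset us u)].
Proof.
move=> uus; have ltu : (index u us < size us)%N by rewrite index_mem.
have [S] := lq_us ltu; rewrite nth_index // => eqS; rewrite eqS.
suff -> : qset us u = S by [].
apply/setP => k; rewrite inE eqS; apply/(ideal_genP S (gen K k))/idP => [/(_ [set k])|kS A].
  by rewrite ffunE eqxx oner_eq0 disjoint_sym disjoints_subset sub1set inE negbK; apply.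
rewrite ffunE; case: (A =P [set k]) => [->|_]; last by rewrite eqxx.
by rewrite disjoint_sym disjoints_subset sub1set inE negbK.
Qed.

Lemma mem_mon u : u \in us -> is_monomial u.
Proof. by move/(allP mon_us). Qed.

Lemma esupp_sub_qset u : u \in us -> esupp u \subset qset us u.
Proof.
move=> uus; apply/subsetP => k ku; rewrite inE mem_colon gen_mul_eq0 ?mem0v //.
exact: mem_mon.
Qed.

Lemma first_index_leq u A : u \in us -> esupp u \subset A ->
  (first_index A <= index u us)%N.
Proof.
move=> uus suA; rewrite leqNgt; apply/negP => /(before_find 0).
by rewrite nth_index // suA.
Qed.

(** Up to sign, [e_A] is [e_(A :\: esupp u)] times [u]. Hence an earlier generator divides [e_A]
    exactly when [e_(A :\: esupp u)] lies in the colon ideal of [u], which is generated by the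
    variables of set(u). *)
Lemma first_index_lt u A : u \in us -> esupp u \subset A ->
  (first_index A < index u us)%N = ~~ [disjoint A :\: esupp u & qset us u].
Proof.
move=> uus suA; have mu := mem_mon uus.
have dAu : [disjoint A :\: esupp u & esupp u] by rewrite disjoints_subset setDE subsetIr.
have [|mM sM] := is_monomialM (is_monomial_basis K (A :\: esupp u)) mu.
  by rewrite esupp_basis.
have {}sM : esupp (ext_basis K (A :\: esupp u) * u) = A.
  by rewrite sM esupp_basis setUC -{1}(setIidPr suA) setID.
rewrite -{1}sM -mem_ideal_take ?index_size // -mem_colon colon_qset //.
apply/(ideal_genP _ (ext_basis K (A :\: esupp u)))/idP => [/(_ (A :\: esupp u))|dA B].
  by rewrite ffunE eqxx oner_eq0 disjoint_sym; apply.
rewrite ffunE; case: (B =P A :\: esupp u) => [->|_]; last by rewrite eqxx.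
by rewrite disjoint_sym.
Qed.

Lemma mem_qset u k : u \in us -> k \notin esupp u ->
  (k \in qset us u) = (first_index (k |: esupp u) < index u us)%N.
Proof.
move=> uus ku; rewrite first_index_lt ?subsetUr //.
have -> : (k |: esupp u) :\: esupp u = [set k].
  apply/setP => i; rewrite !inE; case: (i =P k) => [->|_]; first by rewrite ku.
  by rewrite andNb.
by rewrite disjoints_subset sub1set in_setC negbK.
Qed.

(** By [first_index_lt] no earlier generator divides [e_A]. This criterion identifies the values of
    the decomposition function after two steps. *)
Lemma first_divisor_eq u A : u \in us -> esupp u \subset A ->
  [disjoint A :\: esupp u & qset us u] -> first_divisor A = u.
Proof.
move=> uus suA dA; rewrite /first_divisor.
suff -> : first_index A = index u us by rewrite nth_index.
apply/eqP; rewrite eqn_leq first_index_leq // leqNgt first_index_lt // dA //.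
Qed.

Lemma first_divisorP u A : u \in us -> esupp u \subset A ->
  [/\ first_divisor A \in us, esupp (first_divisor A) \subset A,
      [disjoint A :\: esupp (first_divisor A) & qset us (first_divisor A)]
    & index (first_divisor A) us = first_index A].
Proof.
move=> uus suA; have hasA : has (fun v => esupp v \subset A) us by apply/hasP; exists u.
have ltA : (first_index A < size us)%N by rewrite -has_find.
have eqA : index (first_divisor A) us = first_index A by rewrite index_uniq.
have memA : first_divisor A \in us by rewrite mem_nth.
have subA : esupp (first_divisor A) \subset A := nth_find 0 hasA.
split=> //; have := first_index_lt memA subA; rewrite eqA ltnn.
by move/esym/negbFE.
Qed.

Section Step.
Variables (u : E) (t : 'I_n).
Hypotheses (uus : u \in us) (tq : t \in qset us u) (tu : t \notin esupp u).

Lemma decomposition_genE :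
  decomposition us (gen K t * u) = first_divisor (t |: esupp u).
Proof.
by have [mM sM] := is_monomial_genM (mem_mon uus) tu; rewrite decompositionE // sM.
Qed.

Lemma decomposition_genP (w := decomposition us (gen K t * u)) :
  [/\ w \in us, esupp w \subset t |: esupp u,
      [disjoint (t |: esupp u) :\: esupp w & qset us w]
    & (index w us < index u us)%N].
Proof.
rewrite /w decomposition_genE.
have [? ? ? ->] := first_divisorP uus (subsetUr [set t] _).
by split=> //; rewrite -mem_qset.
Qed.

Lemma notin_qset_step k (w := decomposition us (gen K t * u)) :
  k \in t |: esupp u -> k \notin esupp w -> k \notin qset us w.
Proof.
have [_ _ dw _] := decomposition_genP; move=> ku kw.
by rewrite (disjointFr dw) // in_setD kw.
Qed.

End Step.

(** The coefficient in the second sum of the differential, extended by 0 so that the sum can run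
    over all variables. *)
Definition step_coef t u : E :=
  if (t \in qset us u) && (t \notin esupp u) then
    (-1) ^+ edeg (decomposition us (gen K t * u))
      * monomial_div (gen K t * u) (decomposition us (gen K t * u))
  else 0.

Section StepCoef.
Variables (u : E) (t : 'I_n).
Hypotheses (uus : u \in us) (tq : t \in qset us u) (tu : t \notin esupp u).
Let w := decomposition us (gen K t * u).

Lemma step_coefM : step_coef t u * w = (-1) ^+ edeg w *: (gen K t * u).
Proof.
have [wus sw _ _] := decomposition_genP uus tq tu.
have [mM sM] := is_monomial_genM (mem_mon uus) tu.
have [|dv _] := monomial_divP mM (mem_mon wus); first by rewrite sM.
by rewrite /step_coef tq tu -mulrA dv signM_scale.
Qed.

Lemma step_coef_monomial : monomial_on ((t |: esupp u) :\: esupp w) (step_coef t u).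
Proof.
have [wus sw _ _] := decomposition_genP uus tq tu.
have [mM sM] := is_monomial_genM (mem_mon uus) tu.
have [|_ ] := monomial_divP mM (mem_mon wus); first by rewrite sM.
by rewrite sM /step_coef tq tu => mdiv; apply: monomial_on_sign.
Qed.

(** The coefficient has degree [edeg u + 1 - edeg w], whose parity is that of the exponent. *)
Lemma step_coef_gen s :
  step_coef t u * gen K s = (-1) ^+ (edeg w + edeg u).+1 *: (gen K s * step_coef t u).
Proof.
have [wus sw _ _] := decomposition_genP uus tq tu.
rewrite (gen_monomial_sign _ step_coef_monomial) signM_scale; congr (_ *: _).
rewrite cardsD (setIidPr sw) cardsU1 tu add1n -[RHS]signr_odd -[LHS]signr_odd.
have := subset_leq_card sw; rewrite cardsU1 tu add1n => lew.
by rewrite (oddB lew) /= oddD /edeg; case: (odd _); case: (odd _).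
Qed.

End StepCoef.

Hypothesis reg_us : regular_decomposition us.

(** * Two successive steps of the decomposition function *)

Section TwoSteps.
Variables (u : E) (t s : 'I_n).
Hypotheses (uus : u \in us) (tq : t \in qset us u) (tu : t \notin esupp u).
Hypotheses (sq : s \in qset us u) (su : s \notin esupp u) (neq_st : s != t).
Let w := decomposition us (gen K t * u).
Let z := first_divisor (s |: (t |: esupp u)).

Lemma notin_esupp_step : s \notin esupp w.
Proof.
have [_ sw _ _] := decomposition_genP uus tq tu.
by apply: contra (subsetP sw s) _; rewrite !inE negb_or neq_st.
Qed.

(** What [w] leaves over is [s], outside set(w) by assumption, and part of [t |: esupp u], outside
    set(w) by the choice of [w]; so [first_divisor_eq] applies to [w]. *)
Lemma two_steps_stay : s \notin qset us w -> w = z.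
Proof.
move=> sw; have [wus sub _ _] := decomposition_genP uus tq tu.
apply/esym/first_divisor_eq => //; first exact: subset_trans sub (subsetUr _ _).
rewrite disjoints_subset; apply/subsetP => k; rewrite !inE => /andP[kw].
case/orP => [/eqP->|ktu]; first by rewrite inE in sw.
have := notin_qset_step uus tq tu _ kw; rewrite !inE; exact.
Qed.

(** Let [v] be the left-hand side, and let [k] be left over by [v]. If [k] is in [s |: esupp w], the
    choice of [v] keeps it out of set(v). Otherwise the choice of [w] keeps it out of set(w), which
    contains set(v) by regularity. *)
Lemma two_steps_move : s \in qset us w -> decomposition us (gen K s * w) = z.
Proof.
move=> sw; have [wus sub _ _] := decomposition_genP uus tq tu.
have sw' := notin_esupp_step.
have [vus subv _ _] := decomposition_genP wus sw sw'.
apply/esym/first_divisor_eq => //.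
  by apply: subset_trans subv _; apply: setUS.
rewrite disjoints_subset; apply/subsetP => k; rewrite in_setD => /andP[kv].
rewrite in_setC => kA; have [kw|kw] := boolP (k \in s |: esupp w).
  exact: notin_qset_step kv.
have : k \in t |: esupp u.
  by move: kA kw; rewrite !inE; case: eqP => //= _ ->.
move=> ktu; have kw' : k \notin esupp w by apply: contra kw; rewrite !inE => ->; rewrite orbT.
have := notin_qset_step uus tq tu ktu kw'; apply/contra/subsetP.
exact: reg_us.
Qed.

(* The part of the coefficient of [f(a - U_(s) - U_(t); z)] in [d (d (f(a; u)))] that
   passes through [f(a - U_(t); w)], or, if this is 0 because [s] is not in set([w]), what
   is left over from the terms in [f(a - U_(s) - U_(t); w)], where then [w = z]. *)
Definition two_steps_coef : E :=
  if s \in qset us w then step_coef t u * step_coef s w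
  else - ((-1) ^+ edeg u *: (gen K s * step_coef t u)).

(** Both branches give the same sign, and it depends on [s] and [t] only through [z], hence
    symmetrically. *)
Lemma two_steps_coefM :
  two_steps_coef * z = (-1) ^+ (edeg z + edeg u).+1 *: (gen K s * (gen K t * u)).
Proof.
have [wus sub _ _] := decomposition_genP uus tq tu.
rewrite /two_steps_coef; case: ifPn => sw.
  have := step_coefM wus sw notin_esupp_step; rewrite (two_steps_move sw) => Dz.
  rewrite (mulr_swap Dz (step_coef_gen uus tq tu s) (step_coefM uus tq tu)).
  congr (_ *: _); rewrite -!exprD -[LHS]signr_odd -[RHS]signr_odd !(oddD, oddS) -/w.
  by case: (odd (edeg w)); case: (odd (edeg z)); case: (odd (edeg u)).
have := step_coefM uus tq tu; rewrite -/w (two_steps_stay sw) => Cz.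
rewrite mulNr -scalerAl -mulrA Cz -scalerAr scalerA -scaleNr; congr (_ *: _).
by rewrite exprS mulN1r -exprD addnC.
Qed.

Lemma two_steps_coef_monomial :
  monomial_on ((s |: (t |: esupp u)) :\: esupp z) two_steps_coef.
Proof.
have [wus sub _ _] := decomposition_genP uus tq tu.
have mt := step_coef_monomial uus tq tu; rewrite -/w in wus sub mt.
have sw' := notin_esupp_step.
rewrite /two_steps_coef; case: ifPn => sw.
  have [vus subv _ _] := decomposition_genP wus sw notin_esupp_step.
  have := monomial_onM mt (step_coef_monomial wus sw notin_esupp_step).
  rewrite two_steps_move // in vus subv *.
  (* The supports of the two coefficients fill the complement of supp(z): an element of supp(z)
     other than [s] lies in supp(w), hence not in the support of the first coefficient. *)
  congr monomial_on; apply/setP => k.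
  have := subsetP sub k; have := subsetP subv k; have : s \notin t |: esupp u.
    by rewrite !inE negb_or neq_st.
  rewrite !in_setU !in_setD !in_setU !in_set1; case: (k =P s) => [->|_] /=.
    by move=> /negPf -> _ _; rewrite andbF /= andbT.
  move=> _; case: (k \in esupp w); case: (k \in esupp z); rewrite ?andbF ?andbT ?orbF //=.
  - by move=> _ /(_ isT) ->.
  - by move=> /(_ isT).
rewrite -(two_steps_stay sw); apply: monomial_onN.
rewrite -signM_scale; apply: monomial_on_sign.
have := monomial_onM (monomial_on_gen K s) mt; congr monomial_on.
apply/setP => k; rewrite !inE; case: (k =P s) => [->|_] //=.
by rewrite andbT sw'.
Qed.


End TwoSteps.

(** Both coefficients are multiples of one [e_B] with [B] disjoint from supp(z), and their products
    with [z] are opposite; [z] can therefore be cancelled. *)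
Lemma two_steps_coef_anti u t s : u \in us ->
  t \in qset us u -> t \notin esupp u -> s \in qset us u -> s \notin esupp u -> s != t ->
  two_steps_coef u t s + two_steps_coef u s t = 0.
Proof.
move=> uus tq tu sq su neq_st.
have neq_ts : t != s by rewrite eq_sym.
have sub : esupp u \subset s |: (t |: esupp u) by rewrite setUA subsetUr.
have [zus _ _ _] := first_divisorP uus sub.
have ms := two_steps_coef_monomial uus tq tu su neq_st.
have mt := two_steps_coef_monomial uus sq su tu neq_ts.
have es := two_steps_coefM uus tq tu su neq_st.
have et := two_steps_coefM uus sq su tu neq_ts.
rewrite setUCA in mt et; set z := first_divisor _ in zus ms mt es et.
apply: (mul_monomial_inj (monomial_onD ms mt) (monomial_on_esupp (mem_mon zus))).
- by rewrite disjoints_subset setDE subsetIr.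
- exact: monomial_coef_neq0 (mem_mon zus).
exact: mulr_anti es et.
Qed.

End LinearQuotientSets.

(** * Exactness of the Cartan complex *)

Section Cartan.
Variables (K : fieldType) (n : nat).
Local Notation E := (exterior K n).
Implicit Types (A U : {set 'I_n}) (a b : 'X_{1..n}) (s t i : 'I_n).
Variables (S : {set 'I_n}) (x : 'X_{1..n} -> E).

Definition insertion_sign (A : {set 'I_n}) (t : 'I_n) : K := (-1) ^+ inversions A [set t].

(** The variables of [S] that occur in [e_A f(a)], in either factor. Moving a variable from one
    factor to the other preserves this set, and with it the choice of [least_active]. *)
Definition active_set (a : 'X_{1..n}) (A : {set 'I_n}) : {set 'I_n} := S :&: (A :|: expsupp a).

Definition least_active (U : {set 'I_n}) : option 'I_n :=
  [pick t | (t \in U) && [forall s in U, (t <= s)%N]].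

Lemma least_activeP (U : {set 'I_n}) :
  if least_active U is Some t then is_true (t \in U) else U = set0.
Proof.
rewrite /least_active; case: pickP => [t /andP[] //| noU].
apply/eqP; apply: contraT => /set0Pn[i iU].
case: (arg_minnP (fun t : 'I_n => val t) iU) => t tU tmin.
by have := noU t; rewrite (tU : t \in U) => /negP[]; apply/forall_inP => s sU; apply: tmin.
Qed.

(* On [e_A f(a)], with [t] the least element of S in A or in supp(a), the homotopy moves
   [e_t] to the divided power part if [t] is in A, and vanishes otherwise; here it is
   written on coordinates. *)
Definition cartan_homotopy (a : 'X_{1..n}) : E :=
  [ffun A => if least_active (active_set a A) is Some t then
     if (t \notin A) && (a t != 0%N) then insertion_sign A t * x (a - U_(t))%MM (t |: A) else 0
   else 0].

Lemma insertion_sign_sq A t : insertion_sign A t * insertion_sign A t = 1.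
Proof. by rewrite /insertion_sign -expr2 sqrr_sign. Qed.

Lemma insertion_sign_setU1 A s t : s \notin A ->
  insertion_sign (s |: A) t = insertion_sign [set s] t * insertion_sign A t.
Proof.
move=> sA; rewrite /insertion_sign inversionsUl ?exprD //.
by rewrite disjoints_subset sub1set inE.
Qed.

Lemma insertion_sign_swap s t : s != t -> insertion_sign [set s] t = - insertion_sign [set t] s.
Proof.
move=> neq_st; rewrite /insertion_sign /inversions !big_set1.
by case: ltngtP => [||/val_inj e]; rewrite ?expr0 ?expr1 ?opprK // e eqxx in neq_st *.
Qed.

Lemma active_set_move a A s : s \in A -> active_set (a + U_(s))%MM (A :\ s) = active_set a A.
Proof.
move=> sA; congr (_ :&: _); apply/setP => i; rewrite !inE mnmDE mnm1E.
by case: (i =P s) => [->|/eqP]; rewrite ?eqxx ?sA ?addn1 // eq_sym => /negPf ->; rewrite addn0.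
Qed.

Hypothesis cycle_x : forall b, \sum_(t in S) x (b + U_(t))%MM * gen K t = 0.
(** This excludes the terms free of variables of [S], which carry the homology of the Cartan
    complex. *)
Hypothesis active_set_x : forall a A, x a A != 0 -> active_set a A != set0.

(** On a cycle the homotopy identity [d h + h d = 1] reduces to [d h x = x]. It is checked at each
    coordinate [A], with [t] the least active variable. *)
Lemma cartan_homotopyP a : \sum_(t in S) cartan_homotopy (a + U_(t))%MM * gen K t = x a.
Proof.
apply/ffunP => A; rewrite sum_ffunE.
under eq_bigr => s _ do rewrite coefM_gen.
rewrite -big_mkcondr /=.
under eq_bigr => s /andP[_ sA] do rewrite ffunE active_set_move //.
have := least_activeP (active_set a A); case: (least_active _) => [t tU | U0]; last first.
  rewrite big1 => [|s _]; last by rewrite mulr0.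
  by apply/esym/eqP; apply: contraT => /active_set_x; rewrite U0 eqxx.
have {tU} [tS tAa] : t \in S /\ (t \in A) || (a t != 0%N).
  by move: tU; rewrite !inE => /andP[].
(* If [t] is in [A], only the summand [s = t] survives: for any other [s] the variable [t] remains
   in [A :\ s], where the homotopy vanishes. *)
have [tA|tA] := boolP (t \in A).
  rewrite (bigD1 t) /= ?tS // big1 ?addr0 => [|s /andP[_ neq_st]]; last first.
    by rewrite !inE tA eq_sym neq_st /= mulr0.
  rewrite !inE eqxx /= mnmDE mnm1E eqxx addn1 /= mulrA insertion_sign_sq mul1r.
  by rewrite addmK setD1K.
rewrite (negPf tA) /= in tAa.
have lea : (U_(t) <= a)%MM.
  by apply/mnm_lepP => i; rewrite mnm1E; case: eqP => [<-|//]; rewrite lt0n.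
(* If [t] is not in [A], the cycle relation in degree [a - U_(t)], at the coordinate [t |: A],
   expresses [x a A] through the other summands. *)
have := congr1 (fun f : E => f (t |: A)) (cycle_x (a - U_(t))%MM).
rewrite sum_ffunE ffunE (bigD1 t) //= coefM_gen !inE eqxx /= setU1K // submK //.
under eq_bigr => s do rewrite coefM_gen.
rewrite -big_mkcondr /= => cyc.
rewrite -[RHS]mul1r -[in RHS](insertion_sign_sq A t) -mulrA.
move/eqP: cyc; rewrite addr_eq0 => /eqP ->.
rewrite mulrN mulr_sumr -sumrN; apply: eq_big => s.
  rewrite !inE; case: (s =P t) => [->|_]; last by rewrite andbT.
  by rewrite (negPf tA) andbF.
move=> /andP[sS sA]; have neq_st : s != t by apply: contraNneq tA => <-.
have sA' : s \notin A :\ s by rewrite !inE eqxx.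
have tA' : t \notin A :\ s by rewrite !inE (negPf tA) andbF.
have -> : (t |: A) :\ s = t |: (A :\ s).
  by apply/setP => i; rewrite !inE; case: (i =P t) => [->|//]; rewrite eq_sym neq_st.
rewrite tA' mnmDE addn_eq0 (negPf tAa) /=.
have -> : (a + U_(s) - U_(t) = a - U_(t) + U_(s))%MM.
  by rewrite [(a + _)%MM]addmC -addmBA // addmC.
have sgnA : insertion_sign A t = - (insertion_sign [set t] s * insertion_sign (A :\ s) t).
  by rewrite -{1}(setD1K sA) insertion_sign_setU1 // (insertion_sign_swap neq_st) mulNr.
rewrite -!/(insertion_sign _ _) insertion_sign_setU1 // sgnA mulNr opprK !mulrA.
by rewrite [_ * _ * insertion_sign [set t] s]mulrAC insertion_sign_sq mul1r [X in _ = X * _]mulrC.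
Qed.

(** This locates the exponents of the homotopy: those of [x] with one variable of [S] added. *)
Lemma cartan_homotopy_neq0 a : cartan_homotopy a != 0 ->
  exists2 t, t \in S & (a t != 0%N) && (x (a - U_(t))%MM != 0).
Proof.
move=> h0; have [A hA] : exists A, cartan_homotopy a A != 0.
  apply/existsP; apply: contraT => /existsPn hA; case/eqP: h0; apply/ffunP => A.
  by rewrite [RHS]ffunE; apply/eqP/negPn.
move: hA; rewrite ffunE; have := least_activeP (active_set a A).
case: (least_active _) => [t|]; last by rewrite eqxx.
rewrite inE => /andP[tS _]; case: ifP => [/andP[_ at0] | _]; last by rewrite eqxx.
rewrite mulf_eq0 negb_or => /andP[_ xA]; exists t => //; rewrite at0.
by apply: contraNneq xA => ->; rewrite ffunE.
Qed.

End Cartan.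

(** * The differential and its square *)

Lemma sum_antisymmetric (V : zmodType) n (P : 'I_n -> 'I_n -> V) :
  (forall t, P t t = 0) -> (forall s t, s != t -> P t s + P s t = 0) ->
  \sum_t \sum_s P t s = 0.
Proof.
move=> P0 Panti.
have split_row (t : 'I_n) : \sum_s P t s =
    \sum_(s < n | (s < t)%N) P t s + \sum_(s < n | (t < s)%N) P t s.
  rewrite (bigID (fun s : 'I_n => (s < t)%N)) /=; congr (_ + _).
  rewrite (bigD1 t) /= ?ltnn // P0 add0r; apply: eq_bigl => s.
  by rewrite -leqNgt ltn_neqAle eq_sym andbC.
under eq_bigr => t _ do rewrite split_row.
rewrite big_split /= [X in _ + X](exchange_big_dep xpredT) //= -big_split /=.
apply: big1 => t _; rewrite -big_split; apply: big1 => s lt_st /=.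
by apply: Panti; apply: contraTneq lt_st => ->; rewrite ltnn.
Qed.

Lemma sum_extend (V : zmodType) n (A B : {set 'I_n}) (f f' h h' : 'I_n -> V) :
  (forall t, t \in A -> f' t = - f t) -> (forall t, t \notin A -> f' t = 0) ->
  (forall t, t \in B -> h t = h' t) -> (forall t, t \notin B -> h' t = 0) ->
  - (\sum_(t in A) f t) + \sum_(t in B) h t = \sum_t (f' t + h' t).
Proof.
move=> ff' f0 hh' h0; rewrite big_split -sumrN /=; congr (_ + _).
  by rewrite big_mkcond; apply: eq_bigr => t _; case: ifPn => [/ff'|/f0] ->.
by rewrite big_mkcond; apply: eq_bigr => t _; case: ifPn => [/hh'|/h0] ->.
Qed.

Lemma linear_sum2 (R : nzRingType) (V W : lmodType R) (d : {linear V -> W}) (J : finType)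
    (c c' : J -> R) (x x' : J -> V) :
  d (\sum_t (c t *: x t + c' t *: x' t)) = \sum_t (c t *: d (x t) + c' t *: d (x' t)).
Proof. by rewrite linear_sum; apply: eq_bigr => t _; rewrite linearD !linearZ. Qed.

Lemma expsupp_sub n (a b : 'X_{1..n}) : expsupp (a - b)%MM \subset expsupp a.
Proof.
by apply/subsetP => k; rewrite !inE mnmBE; apply: contraNneq => ->; rewrite sub0n.
Qed.

Lemma mdeg_subU n (a : 'X_{1..n}) t : a t != 0%N -> (mdeg (a - U_(t))).+1 = mdeg a.
Proof.
move=> at0; have lea : (U_(t) <= a)%MM.
  by apply/mnm_lepP => i; rewrite mnm1E; case: eqP => [<-|//]; rewrite lt0n.
by rewrite -[in RHS](submK lea) mdegD mdeg1 addn1.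
Qed.

(** Subtraction is truncated: removing an absent variable does not lower the degree, so the
    resulting [f] has the wrong degree and is 0 by the convention on [res_basis]. *)
Lemma subU_id n (a : 'X_{1..n}) t : a t = 0%N -> (a - U_(t))%MM = a.
Proof.
by move=> at0; apply/mnmP => i; rewrite mnmBE mnm1E; case: eqP => [<-|]; rewrite ?at0 ?subn0.
Qed.

Section Differential.
Variables (K : fieldType) (n : nat) (us : seq (exterior K n)).
Local Notation E := (exterior K n).
Local Notation F := (res_basis us).
Implicit Types (u v w : E) (s t k : 'I_n) (a b : 'X_{1..n}) (i j : nat).

Definition admissible j a u : bool :=
  [&& mdeg a == j, u \in us & expsupp a \subset qset us u].

Lemma admissible_index j (p : res_index us j) :
  admissible j (bmnm (val p).1) (ssval (val p).2).
Proof.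
have /andP[pj ps] := valP p; apply/and3P; split=> //; exact: ssvalP.
Qed.

Lemma index_of_admissible j a u : admissible j a u ->
  exists p : res_index us j, bmnm (val p).1 = a /\ ssval (val p).2 = u.
Proof.
case/and3P=> /eqP aj uus au; have lta : (mdeg a < j.+1)%N by rewrite aj.
have adm : (mdeg (BMultinom lta) == j)
    && (expsupp (BMultinom lta) \subset qset us (ssval (SeqSub uus))).
  by rewrite /= aj eqxx au.
by exists (Sub (BMultinom lta, SeqSub uus) adm).
Qed.

Lemma res_index_inj j (p q : res_index us j) :
  bmnm (val p).1 = bmnm (val q).1 -> ssval (val p).2 = ssval (val q).2 -> p = q.
Proof.
move=> e1 e2; apply/val_inj; rewrite [LHS]surjective_pairing [RHS]surjective_pairing.
by congr pair; apply/val_inj.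
Qed.

Lemma res_basis_eq0 j a u : ~~ admissible j a u -> F j a u = 0.
Proof.
move=> nadm; apply/ffunP => p; rewrite !ffunE; case: eqP => [pa|//] /=; case: eqP => [pu|//].
by rewrite -pa -pu admissible_index in nadm.
Qed.

Definition boundary i a u : res_module us i :=
  match i with
  | 0 => (-1) ^+ edeg u * u
  | j.+1 =>
     - (\sum_(t in expsupp a) ((-1) ^+ edeg u * gen K t) *: F j (a - U_(t))%MM u)
     + \sum_(t in expsupp a :\: esupp u)
          ((-1) ^+ edeg (decomposition us (gen K t * u))
           * monomial_div (gen K t * u) (decomposition us (gen K t * u)))
          *: F j (a - U_(t))%MM (decomposition us (gen K t * u))
  end.

Definition res_diff i (x : res_module us i.+1) : res_module us i :=
  \sum_(p : res_index us i)
     (x : {ffun res_index us i -> E}) p *: boundary i (bmnm (val p).1) (ssval (val p).2).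

Fact res_diff_linear i : linear (@res_diff i).
Proof.
move=> c x y; rewrite /res_diff scaler_sumr -big_split; apply: eq_bigr => p _ /=.
by rewrite !ffunE scalerDl scalerA.
Qed.

HB.instance Definition _ i :=
  GRing.isLinear.Build E (res_module us i.+1) (res_module us i) _ (@res_diff i)
    (@res_diff_linear i).

Lemma res_diffB i (x y : res_module us i.+1) : res_diff (x - y) = res_diff x - res_diff y.
Proof. exact: (linearB (@res_diff i)). Qed.

Lemma res_diffD i (x y : res_module us i.+1) : res_diff (x + y) = res_diff x + res_diff y.
Proof. exact: (linearD (@res_diff i)). Qed.

Lemma res_diffZ i (c : E) (x : res_module us i.+1) : res_diff (c *: x) = c *: res_diff x.
Proof. exact: (linearZZ (@res_diff i)). Qed.

Lemma res_diff0 i : res_diff (0 : res_module us i.+1) = 0.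
Proof. exact: (linear0 (@res_diff i)). Qed.

Lemma res_diff_basis i a u :
  res_diff (F i a u) = if admissible i a u then boundary i a u else 0.
Proof.
case: ifP => [/index_of_admissible[p [pa pu]] | /negbT/res_basis_eq0 ->]; last first.
  exact: res_diff0.
rewrite /res_diff (bigD1 p) //= big1 => [|q neq_qp].
  by rewrite ffunE pa pu !eqxx scale1r addr0.
rewrite ffunE; case: eqP => [qa|_]; last by rewrite scale0r.
case: eqP => [qu|_]; last by rewrite scale0r.
by case/eqP: neq_qp; apply: res_index_inj; rewrite ?pa ?pu.
Qed.

Lemma res_diff_sum i (c c' : 'I_n -> E) (x x' : 'I_n -> res_module us i.+1) :
  res_diff (\sum_t (c t *: x t + c' t *: x' t)) =
  \sum_t (c t *: res_diff (x t) + c' t *: res_diff (x' t)).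
Proof. exact: (linear_sum2 (@res_diff i)). Qed.

Lemma boundaryE j a u : admissible j.+1 a u ->
  boundary j.+1 a u = \sum_t
    (- ((-1) ^+ edeg u * gen K t) *: F j (a - U_(t))%MM u
     + step_coef us t u *: F j (a - U_(t))%MM (decomposition us (gen K t * u))).
Proof.
case/and3P=> /eqP aj uus au.
have F0 t v : t \notin expsupp a -> F j (a - U_(t))%MM v = 0.
  rewrite inE negbK => /eqP at0; rewrite res_basis_eq0 // /admissible subU_id //.
  by rewrite aj eqn_leq ltnn.
apply: sum_extend => t.
- by move=> _; rewrite scaleNr.
- by move=> ta; rewrite F0 // scaler0.
- by rewrite in_setD => /andP[tu ta]; rewrite /step_coef tu (subsetP au).
- rewrite in_setD negb_and negbK => /orP[tu|ta]; last by rewrite F0 ?scaler0.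
  by rewrite /step_coef tu andbF scale0r.
Qed.

End Differential.

Lemma first_square (K : fieldType) n (x y u w : exterior K n) k l :
  y * w = (-1) ^+ k *: (x * u) ->
  - ((-1) ^+ l * x) * ((-1) ^+ l * u) + y * ((-1) ^+ k * w) = 0.
Proof.
move=> yw; rewrite !signM_scale -!scalerAr yw mulNr -scalerAl.
by rewrite !scalerN !scalerA -!expr2 !sqrr_sign !scale1r addNr.
Qed.

(** With [y] a step coefficient and [e] a variable, this cancels the two paths that differ in
    whether [e] is removed before or after the step. *)
Lemma coef_cancel (K : fieldType) n (y e : exterior K n) k l :
  y * e = (-1) ^+ (k + l).+1 *: (e * y) ->
  - ((-1) ^+ l * e) * y + y * - ((-1) ^+ k * e) = 0.
Proof.
move=> ye; rewrite !signM_scale mulNr mulrN -scalerAl -scalerAr ye scalerA.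
rewrite -exprD addnS addnA addnn exprS exprD -muln2 exprM sqrr_sign mul1r.
by rewrite mulN1r scaleNr opprK addNr.
Qed.

Lemma sign_scaleN (K : fieldType) n (x y : exterior K n) k :
  - ((-1) ^+ k * x) * y = - ((-1) ^+ k *: (x * y)).
Proof. by rewrite signM_scale mulNr scalerAl. Qed.

(* Stated over an abstract ring because, over [exterior K n] itself, unification unfolds
   the ring structure and does not terminate in practice. *)
Section FormalFaces.
Variables (R : nzRingType) (V : lmodType R).

(** Paths that keep [u] twice cancel because the [c t] anticommute. The others are grouped by the
    variable [s] of the step that leaves [u], which pairs [c t * d s] with [q s t]. *)
Lemma sum_faces_eq0 n (c d : 'I_n -> R) (x y q : 'I_n -> 'I_n -> V) :
  (forall t, c t * c t = 0) -> (forall s t, c s * c t + c t * c s = 0) ->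
  (forall s t, x s t = x t s) ->
  (forall t, (c t * d t) *: y t t + q t t = 0) ->
  (forall s t, s != t ->
     ((c t * d s) *: y s t + q s t) + ((c s * d t) *: y t s + q t s) = 0) ->
  \sum_t \sum_s (c t *: (c s *: x t s + d s *: y s t) + q t s) = 0.
Proof.
move=> c0 cc xx yq0 yq; apply: sum_antisymmetric => [t|s t neq_st].
  by rewrite scalerDr !scalerA c0 scale0r add0r.
rewrite !scalerDr !scalerA (xx s t) [LHS](AC (3*3) ((1*4)*((2*6)*(5*3)))) /=.
by rewrite -scalerDl cc scale0r add0r yq.
Qed.

Lemma scale_sum_if (J : finType) (b b' : bool) (c c' : R) (h h' : J -> V) :
  c *: (if b then \sum_s h s else 0) + c' *: (if b' then \sum_s h' s else 0)
  = \sum_s ((if b then c *: h s else 0) + (if b' then c' *: h' s else 0)).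
Proof.
rewrite big_split /=; case: b; case: b'; by rewrite ?scaler_sumr ?scaler0 ?big1_eq.
Qed.

Lemma scale_if0 (b : bool) (c d d' : R) :
  (if b then c *: (d *: (0 : V) + d' *: 0) else 0) = 0.
Proof. by rewrite !scaler0 addr0 scaler0 if_same. Qed.

Lemma add_scale_pair0 (c d d' : R) : 0 + 0 = c *: (d *: (0 : V) + d' *: 0) + 0.
Proof. by rewrite !scaler0 !addr0 scaler0. Qed.

Lemma add_scale0 (c : R) : c *: 0 + 0 = 0 :> V.
Proof. by rewrite scaler0 addr0. Qed.

Lemma detour_zero (b : bool) (c d c' d' : R) (y y' : V) : d = 0 ->
  (c * d) *: y + (if b then d *: (c' *: y + d' *: y') else 0) = 0.
Proof. by move->; rewrite mulr0 !scale0r add0r if_same. Qed.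

Lemma detour_stay (b : bool) (c d c' d' : R) (y y' : V) : b = false ->
  (c * d) *: y + (if b then d *: (c' *: y + d' *: y') else 0) = (c * d) *: y.
Proof. by move->; rewrite addr0. Qed.

(** The two contributions ending in [y] cancel and the one in [y'] remains. If the intermediate
    basis element is absent, both end terms must vanish as well. *)
Lemma detour_move (b : bool) (c d c' d' : R) (y y' : V) :
  c * d + d * c' = 0 -> (~~ b -> y = 0 /\ y' = 0) ->
  (c * d) *: y + (if b then d *: (c' *: y + d' *: y') else 0) = (d * d') *: y'.
Proof.
move=> cd; case: b => [_|[]//-> ->]; last by rewrite !scaler0 addr0.
by rewrite scalerDr !scalerA addrA -scalerDl cd scale0r add0r.
Qed.

Lemma scale_eq0l (c : R) (y : V) : c = 0 -> c *: y = 0.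
Proof. by move->; rewrite scale0r. Qed.

Lemma scale_eqDN (c c' : R) (y : V) : c + c' = 0 -> c *: y + c' *: y = 0.
Proof. by move=> cc; rewrite -scalerDl cc scale0r. Qed.

End FormalFaces.

Section SquareZero.
Variables (K : fieldType) (n : nat) (us : seq (exterior K n)).
Hypotheses (mon_us : all (@is_monomial K n) us) (uniq_us : uniq us).
Hypothesis lq_us : linear_quotients us.
Hypothesis reg_us : regular_decomposition us.
Local Notation E := (exterior K n).
Local Notation F := (res_basis us).
Local Notation C := (step_coef us).
Local Notation g t u := (decomposition us (gen K t * u)).
Implicit Types (u v w : E) (s t k : 'I_n) (a b : 'X_{1..n}) (i j : nat).

(** The lowest case is separate because d(f(0; u)) has its own form. Here [a] is a single [U_(t)],
    and both terms are [e_t u] up to opposite signs, or 0 if [t] is in supp(u). *)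
Lemma res_diff_boundary0 a u : admissible us 1 a u -> res_diff (boundary us 1 a u) = 0.
Proof.
move=> adm; have /and3P[/eqP a1 uus au] := adm.
have /mdeg1P[t /eqP aE] : mdeg a == 1%N by rewrite a1.
rewrite boundaryE // res_diff_sum (bigD1 t) //= big1 ?addr0 => [|s neq_st]; last first.
  have at0 : a s = 0%N by rewrite aE mnm1E eq_sym (negPf neq_st).
  by rewrite !res_diff_basis subU_id // /admissible a1 !scaler0 addr0.
have a0 : (a - U_(t))%MM = 0%MM by apply/mnmP => k; rewrite aE mnmBE subnn mnm0E.
have adm0 v : v \in us -> admissible us 0 (a - U_(t)) v.
  move=> vus; rewrite /admissible a0 mdeg0 vus /=; apply/subsetP => k.
  by rewrite inE mnm0E eqxx.
have tq : t \in qset us u by apply: (subsetP au); rewrite inE aE mnm1E eqxx.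
rewrite !res_diff_basis adm0 //.
case: (boolP (t \in esupp u)) => tu.
  rewrite /step_coef tu andbF scale0r addr0.
  have tu0 := gen_mul_eq0 (mem_mon mon_us uus) tu.
  rewrite -[LHS]/(- ((-1) ^+ edeg u * gen K t) * ((-1) ^+ edeg u * u)).
  by rewrite !signM_scale -scalerAr mulNr -scalerAl tu0 scaler0 oppr0 scaler0.
have [wus _ _ _] := decomposition_genP mon_us uniq_us lq_us uus tq tu.
rewrite adm0 //.
have Cw := step_coefM mon_us uniq_us lq_us uus tq tu.
exact: first_square Cw.
Qed.


(** * The square computed with basis elements as formal symbols *)

Section Square.
Variables (V : lmodType E) (f : 'X_{1..n} -> E -> V).
Variables (j : nat) (a : 'X_{1..n}) (u : E).
Hypothesis f_eq0 : forall b v, ~~ admissible us j b v -> f b v = 0.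
Hypothesis adm_a : admissible us j.+2 a u.

Definition formal_boundary b v : V :=
  if admissible us j.+1 b v then
    \sum_t (- ((-1) ^+ edeg v * gen K t) *: f (b - U_(t))%MM v
            + C t v *: f (b - U_(t))%MM (g t v))
  else 0.

Definition face_tail t s : V :=
  if admissible us j.+1 (a - U_(t))%MM (g t u) then
    C t u *: (- ((-1) ^+ edeg (g t u) * gen K s) *: f (a - U_(t) - U_(s))%MM (g t u)
              + C s (g t u) *: f (a - U_(t) - U_(s))%MM (g s (g t u)))
  else 0.

Lemma subUC t s : (a - U_(t) - U_(s) = a - U_(s) - U_(t))%MM.
Proof. by rewrite !submDA addmC. Qed.

Let deg_a : mdeg a = j.+2. Proof. by have /and3P[/eqP] := adm_a. Qed.
Let uus : u \in us. Proof. by have /and3P[] := adm_a. Qed.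
Let supp_a : expsupp a \subset qset us u. Proof. by have /and3P[] := adm_a. Qed.

Lemma qset_of_expsupp t : a t != 0%N -> t \in qset us u.
Proof. by move=> at0; apply: (subsetP supp_a); rewrite inE. Qed.

(** One of the two truncated subtractions is idle, so the degree is still above [j]. *)
Lemma sub2_eq0 t s v : (a t == 0%N) || ((a - U_(t))%MM s == 0%N) ->
  f (a - U_(t) - U_(s))%MM v = 0.
Proof.
move=> ats; apply: f_eq0; rewrite /admissible; apply/negP => /andP[/eqP degj _].
have leU (b : 'X_{1..n}) k : (mdeg b <= (mdeg (b - U_(k))).+1)%N.
  have [bk|bk] := eqVneq (b k) 0%N; last by rewrite mdeg_subU.
  by rewrite subU_id.
case/orP: ats => /eqP at0.
  have := leU (a - U_(t))%MM s; rewrite degj subU_id // deg_a.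
  by rewrite ltnn.
have := leU a t; rewrite -(subU_id at0) degj deg_a.
by rewrite ltnn.
Qed.

Lemma face_tail_eq0 t s : (a t == 0%N) || ((a - U_(t))%MM s == 0%N) -> face_tail t s = 0.
Proof. by move=> ats; rewrite /face_tail !(sub2_eq0 _ ats) scale_if0. Qed.

Lemma face_sum t :
  - ((-1) ^+ edeg u * gen K t) *: formal_boundary (a - U_(t))%MM u
  + C t u *: formal_boundary (a - U_(t))%MM (g t u)
  = \sum_s (- ((-1) ^+ edeg u * gen K t)
      *: (- ((-1) ^+ edeg u * gen K s) *: f (a - U_(t) - U_(s))%MM u
          + C s u *: f (a - U_(s) - U_(t))%MM (g s u)) + face_tail t s).
Proof.
rewrite /formal_boundary scale_sum_if; apply: eq_bigr => s _.
case: ifPn => [_|nadm]; first by rewrite /= (subUC s t).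
have at0 : a t == 0%N.
  apply: contraR nadm => at0; apply/and3P; split=> //.
    by rewrite -eqSS mdeg_subU // deg_a.
  exact: subset_trans (expsupp_sub _ _) supp_a.
have f0 v : f (a - U_(t) - U_(s))%MM v = 0 by rewrite sub2_eq0 ?at0.
have q0 : face_tail t s = 0 by rewrite face_tail_eq0 ?at0.
by rewrite -/(face_tail t s) q0 (subUC s t) !f0; apply: add_scale_pair0.
Qed.

(** All paths that remove [s] and [t] and leave [u] through [g(e_s u)]: the first term removes [t]
    beforehand, [face_tail] afterwards. *)
Definition detour s t : V :=
  (- ((-1) ^+ edeg u * gen K t) * C s u) *: f (a - U_(s) - U_(t))%MM (g s u)
  + face_tail s t.

Lemma detourE s t : a s != 0%N -> (a - U_(s))%MM t != 0%N ->
  detour s t =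
  if [&& s \notin esupp u, t \notin esupp u & t != s] then
    two_steps_coef us u s t
      *: f (a - U_(s) - U_(t))%MM (first_divisor us (t |: (s |: esupp u)))
  else 0.
Proof.
move=> as0 at1; have at0 : a t != 0%N.
  by apply: contraNneq at1 => at0; rewrite mnmBE at0 sub0n.
have [sq tq] := (qset_of_expsupp as0, qset_of_expsupp at0).
rewrite /detour /face_tail; set b := (a - U_(s) - U_(t))%MM.
have [su|su] /= := boolP (s \in esupp u).
  by apply: detour_zero; rewrite /step_coef su andbF.
have [wus sub dw _] := decomposition_genP mon_us uniq_us lq_us uus sq su.
have Ct := step_coef_gen mon_us uniq_us lq_us uus sq su t.
have mC := step_coef_monomial mon_us uniq_us lq_us uus sq su.
have no_q k : k \in s |: esupp u -> k \notin esupp (g s u) -> k \notin qset us (g s u).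
  exact: notin_qset_step.
have wq := esupp_sub_qset mon_us wus.
have stay := two_steps_stay mon_us uniq_us lq_us uus sq su (t := s) (s := t).
have move_ := two_steps_move mon_us uniq_us lq_us reg_us uus sq su (t := s) (s := t).
have nsw := notin_esupp_step mon_us uniq_us lq_us uus sq su (t := s) (s := t).
set w := g s u in wus sub dw Ct mC no_q wq stay move_ nsw *.
(* For [t] outside set(w) the tail is 0 and one term ending in [w] is left over. *)
have [tw|tw] := boolP (t \in qset us w); last first.
  have adm_w : admissible us j.+1 (a - U_(s)) w = false.
    apply/negP => /and3P[_ _ /subsetP/(_ t)]; rewrite inE at1 (negPf tw).
    by move/(_ isT).
  rewrite detour_stay // sign_scaleN.
  have [tsu|] := boolP (t \in s |: esupp u).
    have -> : [&& t \notin esupp u & t != s] = false.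
      by move: tsu; rewrite !inE; case: (t == s) => /= [|->]; rewrite ?andbF.
    (* Here [t] is outside supp(w), hence in the support of the step coefficient, which [e_t]
       therefore kills. *)
    apply: scale_eq0l; rewrite (gen_mul_monomial_eq0 mC) ?scaler0 ?oppr0 //.
    by rewrite in_setD tsu andbT; apply: contra tw; apply/subsetP.
  rewrite !inE negb_or => /andP[neq_ts tu]; rewrite neq_ts tu /=.
  by rewrite /two_steps_coef -/w (negPf tw) -stay.
(* If the pair of [b] and [v] were admissible, adding back [t], which lies in set(w), would make the
   pair of [a - U_(s)] and [w] admissible. *)
have nadm v : v \in us -> qset us v \subset qset us w ->
    ~~ admissible us j.+1 (a - U_(s)) w -> f b v = 0.
  move=> vus sub_vw nadm; apply: f_eq0; apply: contra nadm.
  move=> /and3P[degb _ suppb]; apply/and3P; split; [|exact: wus|].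
    by rewrite -(mdeg_subU at1) (eqP degb).
  apply/subsetP => k; rewrite inE => ak; have [-> //|neq_kt] := eqVneq k t.
  apply: (subsetP sub_vw); apply: (subsetP suppb).
  by rewrite inE mnmBE mnm1E [t == k]eq_sym (negPf neq_kt) subn0.
have [tsu|] := boolP (t \in s |: esupp u).
  have -> : [&& t \notin esupp u & t != s] = false.
    by move: tsu; rewrite !inE; case: (t == s) => /= [|->]; rewrite ?andbF.
  have tew : t \in esupp w.
    by apply: contraLR tw; apply: no_q.
  have Ctw : C t w = 0 by rewrite /step_coef tew andbF.
  case: ifPn => [_|/(nadm w wus (subxx _)) ->]; last exact: add_scale0.
  apply: etrans (@detour_move _ _ true _ _ _ _ _ _ (coef_cancel Ct) _) _ => //.
  by apply: scale_eq0l; rewrite Ctw mulr0.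
rewrite !inE negb_or => /andP[neq_ts tu]; rewrite neq_ts tu /=.
have tw' := nsw tu neq_ts.
have [zus _ _ _] := decomposition_genP mon_us uniq_us lq_us wus tw tw'.
have sub_z := reg_us wus tw tw'.
rewrite /two_steps_coef -/w tw.
rewrite move_ // in zus sub_z *.
apply: (@detour_move _ _ _ _ _ _ _ _ _ (coef_cancel Ct)) => nw.
by split; [exact: nadm wus (subxx _) nw | exact: nadm zus sub_z nw].
Qed.

Lemma formal_boundary_square :
  \sum_t (- ((-1) ^+ edeg u * gen K t) *: formal_boundary (a - U_(t))%MM u
          + C t u *: formal_boundary (a - U_(t))%MM (g t u)) = 0.
Proof.
under eq_bigr => t _ do rewrite face_sum.
(* Two variables can be removed from [a] in one order exactly when they can in the other. *)
have good t s : ~~ ((a t == 0%N) || ((a - U_(t))%MM s == 0%N)) ->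
    [/\ a t != 0%N, a s != 0%N, (a - U_(t))%MM s != 0%N & (a - U_(s))%MM t != 0%N].
  rewrite negb_or => /andP[at0 as1].
  have as0 : a s != 0%N by apply: contraNneq as1 => as0; rewrite mnmBE as0 sub0n.
  split=> //; move: as1; rewrite !mnmBE !mnm1E [s == t]eq_sym.
  by case: (t =P s) => [->//|_]; rewrite !subn0.
have bad s t : (a s == 0%N) || ((a - U_(s))%MM t == 0%N) -> detour s t = 0.
  by move=> ast; rewrite /detour face_tail_eq0 // sub2_eq0 // add_scale0.
apply: sum_faces_eq0 => [t|s t|s t|t|s t neq_st].
- by rewrite mulrNN !signM_scale -scalerAl -scalerAr gen_sqr !scaler0.
- by rewrite !mulrNN !signM_scale -!scalerAl -!scalerAr gen_anticomm !scalerN addNr.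
- by rewrite subUC.
- rewrite -/(detour t t).
  have [/bad //|/good[at0 _ at1 _]] := boolP ((a t == 0%N) || ((a - U_(t))%MM t == 0%N)).
  by rewrite detourE // eqxx !andbF.
rewrite -/(detour s t) -/(detour t s).
have [ast|] := boolP ((a s == 0%N) || ((a - U_(s))%MM t == 0%N)).
  rewrite !bad ?addr0 //.
  by apply: contraLR ast => /good[at0 as0 at1 as1]; rewrite negb_or as0.
case/good=> as0 at0 at1 as1; rewrite !detourE // [t == s]eq_sym neq_st !andbT andbC.
case: ifP => [/andP[tu su]|_]; last exact: addr0.
rewrite subUC setUCA; apply: scale_eqDN.
by apply: two_steps_coef_anti => //; rewrite ?qset_of_expsupp // eq_sym.
Qed.

End Square.

Lemma res_diff_boundaryS j a u :
  admissible us j.+2 a u -> res_diff (boundary us j.+2 a u) = 0.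
Proof.
move=> adm; rewrite boundaryE // res_diff_sum.
rewrite -[RHS](@formal_boundary_square _ (@res_basis K n us j) j a u (@res_basis_eq0 _ _ _ j) adm).
have e b v : res_diff (F j.+1 b v) = formal_boundary (@res_basis K n us j) j b v.
  by rewrite res_diff_basis /formal_boundary; case: ifP => // adm'; apply: boundaryE.
by apply: eq_bigr => t _; rewrite !e.
Qed.

End SquareZero.

(** * Exactness *)

Lemma linear_sumZ (R : nzRingType) (V W : lmodType R) (d : {linear V -> W}) (J : finType)
    (c : J -> R) (x : J -> V) : d (\sum_p c p *: x p) = \sum_p c p *: d (x p).
Proof. by rewrite linear_sum; apply: eq_bigr => p _; rewrite linearZ. Qed.

Lemma sum_scale0 (R : nzRingType) (V : lmodType R) (J : finType) (c : J -> R) (x : J -> V) :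
  (forall p, x p = 0) -> \sum_p c p *: x p = 0.
Proof. by move=> x0; apply: big1 => p _; rewrite x0 scaler0. Qed.

Lemma ffun_sum2 (R : nzRingType) (T J : finType) (c d : J -> R)
    (x y : J -> {ffun T -> R^o}) (p : T) :
  (\sum_t (c t *: x t + d t *: y t)) p = \sum_t (c t * x t p + d t * y t p).
Proof. by rewrite sum_ffunE; apply: eq_bigr => t _; rewrite !ffunE. Qed.

Lemma ffun_sumZ (R : nzRingType) (T J : finType) (c : J -> R)
    (x : J -> {ffun T -> R^o}) (p : T) :
  (\sum_t c t *: x t) p = \sum_t c t * x t p.
Proof. by rewrite sum_ffunE; apply: eq_bigr => t _; rewrite !ffunE. Qed.

Section Coordinates.
Variables (K : fieldType) (n : nat) (us : seq (exterior K n)).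
Local Notation E := (exterior K n).
Local Notation g t u := (decomposition us (gen K t * u)).
Implicit Types (u v w : E) (s t k : 'I_n) (a b : 'X_{1..n}) (i j : nat).

(** The coordinates extended by 0 to all pairs, the total form that the Cartan homotopy takes as
    input. *)
Definition coef_at j (x : {ffun res_index us j -> E}) a u : E :=
  \sum_(p | (bmnm (val p).1 == a) && (ssval (val p).2 == u)) x p.

Lemma coef_atE j (x : {ffun res_index us j -> E}) (p : res_index us j) :
  coef_at x (bmnm (val p).1) (ssval (val p).2) = x p.
Proof.
apply: big_pred1 => q; apply/andP/eqP => [[/eqP qa /eqP qu]|->]; last by rewrite !eqxx.
exact: res_index_inj qa qu.
Qed.

Lemma coef_at_neq0 j (x : {ffun res_index us j -> E}) a u :
  coef_at x a u != 0 ->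
  exists p, [/\ bmnm (val p).1 = a, ssval (val p).2 = u & coef_at x a u = x p].
Proof.
move=> x0; have [/existsP[p /andP[/eqP pa /eqP pu]]|nop] :=
    boolP [exists p : res_index us j, (bmnm (val p).1 == a) && (ssval (val p).2 == u)].
  by exists p; split=> //; rewrite -pa -pu coef_atE.
case/eqP: x0; apply: big_pred0 => p; apply/negP => pau.
by case/negP: nop; apply/existsP; exists p.
Qed.

Lemma coef_at_admissible j (x : {ffun res_index us j -> E}) a u :
  coef_at x a u != 0 -> admissible us j a u.
Proof. by case/coef_at_neq0 => p [<- <- _]; apply: admissible_index. Qed.

Lemma res_diff_square i (x : res_module us i.+2) :
  (forall a u, admissible us i.+1 a u -> res_diff (boundary us i.+1 a u) = 0) ->
  res_diff (res_diff x) = 0.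
Proof.
move=> bd0; rewrite [in X in res_diff X]/res_diff (linear_sumZ (@res_diff _ _ us i)).
by apply: sum_scale0 => p; apply: bd0; apply: admissible_index.
Qed.

Lemma boundary_coef j a u (c : res_index us j) : admissible us j.+1 a u ->
  (boundary us j.+1 a u : {ffun res_index us j -> E}) c = \sum_t
    (- ((-1) ^+ edeg u * gen K t)
       * ((bmnm (val c).1 == (a - U_(t))%MM) && (ssval (val c).2 == u))%:R
     + step_coef us t u
       * ((bmnm (val c).1 == (a - U_(t))%MM) && (ssval (val c).2 == g t u))%:R).
Proof.
move=> adm; rewrite boundaryE //; apply: etrans (ffun_sum2 _ _ _ _ _) _.
by apply: eq_bigr => t _; rewrite /res_basis 2!ffunE.
Qed.

Lemma res_diff_coef j (x : {ffun res_index us j.+1 -> E}) (c : res_index us j) :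
  (res_diff (x : res_module us j.+2) : {ffun res_index us j -> E}) c =
  \sum_p x p * (boundary us j.+1 (bmnm (val p).1) (ssval (val p).2)
                 : {ffun res_index us j -> E}) c.
Proof. exact: ffun_sumZ. Qed.

Hypotheses (mon_us : all (@is_monomial K n) us) (uniq_us : uniq us).
Hypothesis lq_us : linear_quotients us.

(** Steps lead to strictly earlier generators, so at or above the top generator of [x] only the
    first sum contributes: up to sign, the Cartan differential on set(v). *)
Lemma res_diff_coef_top j (x : {ffun res_index us j.+1 -> E}) (c : res_index us j)
    (v := ssval (val c).2) :
  (forall p, x p != 0 -> (index (ssval (val p).2) us <= index v us)%N) ->
  (res_diff (x : res_module us j.+2) : {ffun res_index us j -> E}) c =
  - \sum_(t in qset us v) (-1) ^+ edeg v *: (coef_at x (bmnm (val c).1 + U_(t))%MM v * gen K t).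
Proof.
move=> top_v; have /and3P[/eqP degc vus suppc] := admissible_index c.
rewrite res_diff_coef.
transitivity (\sum_p \sum_t - ((-1) ^+ edeg v *:
   (x p * ((bmnm (val p).1 == bmnm (val c).1 + U_(t))%MM && (ssval (val p).2 == v))%:R * gen K t))).
  apply: eq_bigr => p _; have [->|xp] := eqVneq (x p) 0.
    by rewrite mul0r; apply/esym/big1 => t _; rewrite !mul0r scaler0 oppr0.
  have adm := admissible_index p; have /and3P[/eqP degp uus suppp] := adm.
  rewrite boundary_coef // mulr_sumr; apply: eq_bigr => t _.
  set u := ssval _ in top_v uus suppp *; set a := bmnm (val p).1 in degp suppp *.
  have -> : step_coef us t u * ((bmnm (val c).1 == (a - U_(t))%MM) && (v == g t u))%:R = 0.
    rewrite /step_coef; case: ifP => [/andP[tq tu]|_]; last by rewrite mul0r.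
    have [_ _ _ lt_gu] := decomposition_genP mon_us uniq_us lq_us uus tq tu.
    case: (v =P _) => [vE|_]; last by rewrite andbF mulr0.
    by have := top_v p xp; rewrite leqNgt vE lt_gu.
  rewrite addr0 [v == u]eq_sym.
  (* Because subtraction is truncated, the degrees are needed to see that [t] occurs in [a]. *)
  have -> : (bmnm (val c).1 == a - U_(t))%MM = (a == bmnm (val c).1 + U_(t))%MM.
    apply/eqP/eqP => [cE|->]; last by rewrite addmK.
    rewrite cE submK //; apply/mnm_lepP => k; rewrite mnm1E.
    case: (t =P k) => [<-|//]; rewrite lt0n; apply/eqP => at0.
    by move: degc; rewrite cE subU_id // degp => /esym /n_Sn.
  case: (a == _); last by rewrite !mulr0 mul0r scaler0 oppr0.
  case: (u =P v) => [<-|_]; last by rewrite !mulr0 mul0r scaler0 oppr0.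
  by rewrite !mulr1 signM_scale mulrN -scalerAr.
rewrite exchange_big -sumrN /= [RHS]big_mkcond; apply: eq_bigr => t _.
transitivity (- ((-1) ^+ edeg v *: (coef_at x (bmnm (val c).1 + U_(t))%MM v * gen K t))).
  rewrite /coef_at mulr_suml scaler_sumr -sumrN [RHS]big_mkcond; apply: eq_bigr => p _.
  by case: ifP => _; rewrite ?mulr1 // mulr0 mul0r scaler0 oppr0.
case: ifPn => // tv; suff -> : coef_at x (bmnm (val c).1 + U_(t))%MM v = 0.
  by rewrite mul0r scaler0 oppr0.
apply/eqP; apply: contraNT tv => /coef_at_admissible /and3P[_ _ /subsetP]; apply.
by rewrite inE mnmDE mnm1E eqxx addn1.
Qed.

End Coordinates.

Section Exactness.
Variables (K : fieldType) (n : nat) (us : seq (exterior K n)).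
Hypotheses (mon_us : all (@is_monomial K n) us) (uniq_us : uniq us).
Hypothesis lq_us : linear_quotients us.
Hypothesis reg_us : regular_decomposition us.
Local Notation E := (exterior K n).
Implicit Types (u v w : E) (s t k : 'I_n) (a b : 'X_{1..n}) (i j m : nat).

Lemma res_diffK i (x : res_module us i.+2) : res_diff (res_diff x) = 0.
Proof.
apply: res_diff_square => a u; case: i x => [|j] _.
  exact: res_diff_boundary0.
exact: res_diff_boundaryS.
Qed.

(** A cycle in F_1 is a relation between generators, up to signs; it writes [x p * u] as a
    combination of generators before [u]. *)
Lemma colon_of_cycle (x : {ffun res_index us 0 -> E}) (p : res_index us 0)
    (u := ssval (val p).2) :
  res_diff (x : res_module us 1) = 0 ->
  (forall q, x q != 0 -> (index (ssval (val q).2) us <= index u us)%N) ->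
  x p \in colon (ideal (take (index u us) us)) u.
Proof.
move=> dx0 top_u; have uus : u \in us := ssvalP _.
pose y q : E := x q * ((-1) ^+ edeg (ssval (val q).2) * ssval (val q).2).
have {dx0} : \sum_q y q = 0 := dx0.
rewrite (bigD1 p) //= => /eqP; rewrite addr_eq0 => /eqP yp.
rewrite mem_colon.
have -> : x p * u = (-1) ^+ edeg u *: y p.
  by rewrite /y -/u signM_scale -scalerAr scalerA -expr2 sqrr_sign scale1r.
rewrite yp memvZ // memvN memv_suml // => q neq_qp.
rewrite /y; have [->|xq] := eqVneq (x q) (0 : E); first by rewrite mul0r mem0v.
have [/eqP a0 qus _] := and3P (admissible_index q).
have [/eqP b0 _ _] := and3P (admissible_index p).
rewrite mulrA ideal_mull // mem_ideal //.
have := top_u q xq; rewrite leq_eqVlt => /orP[/eqP eqi|ltqp].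
  case/eqP: neq_qp; apply: res_index_inj.
    move/eqP: a0; move/eqP: b0; rewrite !mdeg_eq0 => /eqP -> /eqP ->; by [].
  by rewrite -[LHS](nth_index 0 qus) eqi nth_index.
rewrite -[ssval (val q).2](nth_index 0 qus) -(nth_take 0 ltqp).
by rewrite mem_nth // size_take_min leq_min ltqp index_mem.
Qed.

(** The homotopy needs the cycle relation for every [b]. It comes from [res_diff_coef_top] when [b]
    is admissible one degree lower, and otherwise all its terms vanish. *)
Lemma cycle_coef i (x : {ffun res_index us i -> E}) v :
  res_diff (x : res_module us i.+1) = 0 ->
  (forall p, x p != 0 -> (index (ssval (val p).2) us <= index v us)%N) ->
  forall b, \sum_(t in qset us v) coef_at x (b + U_(t))%MM v * gen K t = 0.
Proof.
move=> dx0 top_v b.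
have [adm|nadm] := boolP ((i != 0%N) && admissible us i.-1 b v); last first.
  apply: big1 => t tv; suff -> : coef_at x (b + U_(t))%MM v = 0 by rewrite mul0r.
  apply/eqP; apply: contraNT nadm => /coef_at_admissible /and3P[/eqP degb vus suppb].
  rewrite mdegD mdeg1 addn1 in degb.
  rewrite /admissible -degb eqxx vus /=; apply: subset_trans suppb.
  by apply/subsetP => k; rewrite !inE mnmDE addn_eq0 negb_and => ->.
case: i x dx0 top_v adm => [|j] x dx0 top_v //= /index_of_admissible[c [cb cv]].
have top_c p : x p != 0 -> (index (ssval (val p).2) us <= index (ssval (val c).2) us)%N.
  by rewrite cv; apply: top_v.
have := res_diff_coef_top mon_us uniq_us lq_us top_c.
rewrite dx0 ffunE cb cv => /eqP; rewrite eq_sym oppr_eq0 -scaler_sumr scaler_eq0.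
by rewrite signr_eq0 => /eqP.
Qed.

(** In F_1 the top coefficient lies in the colon ideal, so [A] meets set(v); in higher degree the
    nonempty supp(a) is contained in set(v). *)
Lemma cycle_active i (x : {ffun res_index us i -> E}) v :
  res_diff (x : res_module us i.+1) = 0 ->
  (forall p, x p != 0 -> (index (ssval (val p).2) us <= index v us)%N) ->
  forall a (A : {set 'I_n}), coef_at x a v A != 0 -> qset us v :&: (A :|: expsupp a) != set0.
Proof.
move=> dx0 top_v a A xA.
have xa : coef_at x a v != 0 by apply: contraNneq xA => ->; rewrite ffunE.
have [p [pa pv xp]] := coef_at_neq0 xa.
have /and3P[/eqP dega vus suppa] := coef_at_admissible xa.
case: i x dx0 top_v p xA xa pa pv xp dega => [|j] x dx0 top_v p xA xa pa pv xp dega.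
  have top_p q : x q != 0 -> (index (ssval (val q).2) us <= index (ssval (val p).2) us)%N.
    by rewrite pv; apply: top_v.
  have := colon_of_cycle dx0 top_p; rewrite colon_qset ?ssvalP // -xp pv.
  move/ideal_genP/(_ A xA); apply: contraNneq => q0; rewrite -setI_eq0 -subset0 -q0.
  by apply: setIS; apply: subsetUl.
rewrite setIUr (setIidPr suppa) setU_eq0 negb_and; apply/orP; right.
apply/eqP => supp0; have a0 : a = 0%MM.
  apply/mnmP => k; rewrite mnm0E; apply/eqP; apply: contraFT (in_set0 k) => ak.
  by rewrite -supp0 inE.
by rewrite a0 mdeg0 in dega.
Qed.

Lemma reduce_top i (x : {ffun res_index us i -> E}) v : v \in us ->
  res_diff (x : res_module us i.+1) = 0 ->
  (forall p, x p != 0 -> (index (ssval (val p).2) us <= index v us)%N) ->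
  exists y : {ffun res_index us i.+1 -> E}, forall p,
    x p != (res_diff (y : res_module us i.+2) : {ffun res_index us i -> E}) p ->
    (index (ssval (val p).2) us < index v us)%N.
Proof.
move=> vus dx0 top_v.
pose h := cartan_homotopy (qset us v) (fun a => coef_at x a v).
have hP a : \sum_(t in qset us v) h (a + U_(t))%MM * gen K t = coef_at x a v.
  apply: (@cartan_homotopyP _ _ _ (fun a => coef_at x a v)).
    exact: cycle_coef dx0 top_v.
  exact: cycle_active dx0 top_v.
have h_adm a : h a != 0 -> admissible us i.+1 a v.
  case/cartan_homotopy_neq0 => t tv /andP[at0 /coef_at_admissible /and3P[/eqP deg _ supp]].
  apply/and3P; split=> //; first by rewrite -(mdeg_subU at0) deg.
  apply/subsetP => k; rewrite inE => ak; have [-> //|neq_kt] := eqVneq k t.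
  by apply: (subsetP supp); rewrite inE mnmBE mnm1E [t == k]eq_sym (negPf neq_kt) subn0.
(* The sign makes up for the factor [- (-1) ^+ edeg v] in [res_diff_coef_top]. *)
pose y : {ffun res_index us i.+1 -> E} :=
  [ffun p => if ssval (val p).2 == v then (-1) ^+ (edeg v).+1 *: h (bmnm (val p).1) else 0].
have y_coef a u : coef_at y a u = if u == v then (-1) ^+ (edeg v).+1 *: h a else 0.
  have [adm|nadm] := boolP (admissible us i.+1 a u).
    have [p [<- <-]] := index_of_admissible adm.
    by rewrite coef_atE ffunE.
  have -> : coef_at y a u = 0 by apply/eqP; apply: contraNT nadm; apply: coef_at_admissible.
  case: (u =P v) => [uv|//]; suff -> : h a = 0 by rewrite scaler0.
  by apply/eqP; apply: contraNT nadm; rewrite uv; apply: h_adm.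
exists y => p; apply: contraNltn => le_vp.
have top_p q : y q != 0 -> (index (ssval (val q).2) us <= index (ssval (val p).2) us)%N.
  by rewrite ffunE; case: (ssval (val q).2 =P v) => [-> //|_]; rewrite eqxx.
rewrite (res_diff_coef_top mon_us uniq_us lq_us top_p); apply/eqP.
have [pv|neq_pv] := eqVneq (ssval (val p).2) v.
  rewrite -coef_atE pv -hP -sumrN; apply: eq_bigr => t _.
  by rewrite y_coef eqxx -scalerAl scalerA exprS mulN1r mulrN -expr2 sqrr_sign scaleN1r opprK.
rewrite big1 ?oppr0 => [|t _]; last by rewrite y_coef (negPf neq_pv) mul0r scaler0.
(* Strictly above [v], both [x] and the boundary of [y] vanish. *)
apply/eqP; apply: contraNT neq_pv => /top_v le_pv.
have pus : ssval (val p).2 \in us := ssvalP _.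
have eqi : index (ssval (val p).2) us = index v us by apply/eqP; rewrite eqn_leq le_pv.
by rewrite -(nth_index 0 pus) eqi nth_index.
Qed.

Lemma res_diff_exact_lt m i (x : {ffun res_index us i -> E}) :
  res_diff (x : res_module us i.+1) = 0 ->
  (forall p, x p != 0 -> (index (ssval (val p).2) us < m)%N) ->
  exists y, res_diff y = x :> res_module us i.+1.
Proof.
elim: m x => [|m IHm] x dx0 lt_x.
  exists 0; rewrite res_diff0; apply/ffunP => p; rewrite ffunE.
  by apply/esym/eqP; apply: contraT => /lt_x.
(* Beyond the last generator the bound says nothing and the induction hypothesis applies as it
   is. *)
have [ltm|lem] := ltnP m (size us); last first.
  apply: IHm => // p _; apply: leq_trans lem; rewrite index_mem; exact: ssvalP.
have mE : index us`_m us = m by rewrite index_uniq.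
have [|y yP] := @reduce_top i x us`_m (mem_nth 0 ltm) dx0.
  by rewrite mE.
pose z : res_module us i.+1 := (x : res_module us i.+1) - res_diff (y : res_module us i.+2).
have [||w dw] := IHm z.
- by rewrite res_diffB dx0 res_diffK subr0.
- move=> p; rewrite !ffunE subr_eq0 => /yP; by rewrite mE.
exists (w + (y : res_module us i.+2)).
by rewrite res_diffD dw subrK.
Qed.

Lemma res_diff_exact i (x : res_module us i.+1) :
  res_diff x = 0 <-> exists y, res_diff y = x.
Proof.
split=> [dx0 | [y <-]]; last exact: res_diffK.
apply: (@res_diff_exact_lt (size us)) dx0 _ => p _; rewrite index_mem; exact: ssvalP.
Qed.

Lemma res_diff_image x : x \in ideal us <-> exists y, res_diff (y : res_module us 1) = x.
Proof.
split=> [xI | [y <-]]; last first.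
  apply: memv_suml => p _; apply: ideal_mull; apply: ideal_mull.
  by apply: mem_ideal; apply: ssvalP.
rewrite (ext_expand x).
elim/big_ind: _ => [|y z [y' dy] [z' dz]|A _].
- by exists 0; rewrite res_diff0.
- by exists (y' + z'); rewrite res_diffD dy dz.
have [->|xA] := eqVneq (x A) 0.
  by exists 0; rewrite res_diff0 scale0r.
have /hasP[u uus suA] := ideal_monomialP x mon_us xI A xA.
have [|eA _] := monomial_divP (is_monomial_basis K A) (mem_mon mon_us uus).
  by rewrite esupp_basis.
(* The last factor cancels the sign in d(f(0; u)). *)
pose c : E := ((x A *: monomial_div (ext_basis K A) u) : E) * (-1) ^+ edeg u.
have adm : admissible us 0 0%MM u.
  by rewrite /admissible mdeg0 uus /=; apply/subsetP => k; rewrite inE mnm0E eqxx.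
have [f df] : exists f : res_module us 1, res_diff f = (-1) ^+ edeg u * u :> E.
  by exists (res_basis us 0 0%MM u); rewrite res_diff_basis adm.
exists (c *: f); rewrite res_diffZ df -[LHS]/(c * ((-1) ^+ edeg u * u)) /c.
rewrite signM_scale -scalerAr -mulrA signM_scale -scalerAr.
by rewrite scalerA -expr2 sqrr_sign scale1r -scalerAl eA.
Qed.

End Exactness.

(** * Grading and minimality *)

Section GradedMinimal.
Variables (K : fieldType) (n : nat) (us : seq (exterior K n)).
Hypotheses (mon_us : all (@is_monomial K n) us) (uniq_us : uniq us).
Hypothesis lq_us : linear_quotients us.
Local Notation E := (exterior K n).
Local Notation g t u := (decomposition us (gen K t * u)).
Implicit Types (u v w x y : E) (s t k : 'I_n) (a b : 'X_{1..n}) (d e i j p : nat).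

(* [x] is homogeneous of degree [e - d], where [e < d] forces [x = 0]. *)
Definition shift_homogeneous d e x : Prop := forall A, x A != 0 -> (#|A| + d)%N = e.

Lemma shift_homogeneous0 d e : shift_homogeneous d e 0.
Proof. by move=> A; rewrite ffunE eqxx. Qed.

Lemma shift_homogeneous_sum (J : finType) (h : J -> E) d e :
  (forall r, shift_homogeneous d e (h r)) -> shift_homogeneous d e (\sum_r h r).
Proof.
move=> hom A; apply: contraNeq => neq; rewrite sum_ffunE big1 // => r _.
by apply/eqP; apply: contraT => /hom /eqP; rewrite (negPf neq).
Qed.

Lemma shift_homogeneousD d e x y : shift_homogeneous d e x -> shift_homogeneous d e y ->
  shift_homogeneous d e (x + y).
Proof.
move=> hx hy A; rewrite ffunE; have [->|/hx //] := eqVneq (x A) 0.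
by rewrite add0r => /hy.
Qed.

Lemma shift_homogeneousM d e p x y : shift_homogeneous e p x -> shift_homogeneous d e y ->
  shift_homogeneous d p (x * y).
Proof.
move=> hx hy C /coefM_neq0[A [B [/hx xA /hy yB dAB ->]]].
by rewrite cardsU disjoint_setI0 // cards0 subn0 -addnA yB.
Qed.

Lemma shift_homogeneous_on d A x : monomial_on A x -> shift_homogeneous d (#|A| + d) x.
Proof.
by move=> -> B; rewrite coefZ_basis; case: (B =P A) => [-> //|_]; rewrite eqxx.
Qed.

Lemma shift_homogeneousP d e x : x != 0 -> shift_homogeneous d e x ->
  exists2 q, homogeneous q x & (q + d)%N = e.
Proof.
move=> x0 hx; have [A xA] : exists A, x A != 0.
  apply/existsP; apply: contraNT x0 => /existsPn nA; apply/eqP/ffunP => A.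
  by rewrite ffunE; apply/eqP/negPn.
exists #|A|; last exact: hx.
apply/forallP => B; apply/implyP => /hx hB.
by rewrite -(eqn_add2r d) hB hx.
Qed.

Lemma homogeneous_shift d e q x : homogeneous q x -> (q + d)%N = e -> shift_homogeneous d e x.
Proof. by move=> /forallP hx <- A xA; have /implyP/(_ xA)/eqP-> := hx A. Qed.

Lemma step_coef_homogeneous u t d : u \in us -> t \in qset us u -> t \notin esupp u ->
  shift_homogeneous (d + edeg (g t u)) (d.+1 + edeg u) (step_coef us t u).
Proof.
move=> uus tq tu; have [wus sub _ _] := decomposition_genP mon_us uniq_us lq_us uus tq tu.
have mC := step_coef_monomial mon_us uniq_us lq_us uus tq tu.
have := shift_homogeneous_on (d + edeg (g t u)) mC.
rewrite cardsD (setIidPr sub) cardsU1 tu /edeg addnCA subnK; last first.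
  by have := subset_leq_card sub; rewrite cardsU1 tu.
by rewrite /= add1n addnS addSn.
Qed.

Lemma boundary_homogeneous j a u (c : res_index us j) : admissible us j.+1 a u ->
  shift_homogeneous (res_deg c) (mdeg a + edeg u)
    ((boundary us j.+1 a u : {ffun res_index us j -> E}) c).
Proof.
move=> adm; have /and3P[/eqP dega uus suppa] := adm.
have /and3P[/eqP degc _ _] := admissible_index c.
have res_degE : res_deg c = (j + edeg (ssval (val c).2))%N by rewrite /res_deg degc.
rewrite boundary_coef // res_degE dega; apply: shift_homogeneous_sum => t.
apply: shift_homogeneousD.
  case: eqP => _ /=; last by rewrite mulr0; apply: shift_homogeneous0.
  case: eqP => [->|_]; last by rewrite mulr0; apply: shift_homogeneous0.
  rewrite mulr1 addSn -add1n -[1%N](cards1 t).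
  apply: shift_homogeneous_on; apply: monomial_onN; apply: monomial_on_sign.
  exact: monomial_on_gen.
case: eqP => _ /=; last by rewrite mulr0; apply: shift_homogeneous0.
case: eqP => [->|_]; last by rewrite mulr0; apply: shift_homogeneous0.
rewrite mulr1; have [/andP[tq tu]|nC] := boolP ((t \in qset us u) && (t \notin esupp u)).
  exact: step_coef_homogeneous.
by rewrite /step_coef (negPf nC); apply: shift_homogeneous0.
Qed.

Lemma res_diff_homogeneous i p (x : res_module us i.+1) :
  res_homogeneous p x -> res_homogeneous p (res_diff x).
Proof.
move=> hom_x.
have hx c : shift_homogeneous (res_deg c) p ((x : {ffun res_index us i -> E}) c).
  have [->|xc] := eqVneq ((x : {ffun res_index us i -> E}) c) (0 : E).
    exact: shift_homogeneous0.
  have [q hq qp] := hom_x c xc; exact: homogeneous_shift hq qp.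
case: i x hom_x hx => [|j] x _ hx.
  suff hd : shift_homogeneous 0 p (res_diff x : E).
    apply/forallP => A; apply/implyP => /hd; rewrite addn0 => ->; exact: eqxx.
  apply: shift_homogeneous_sum => c; apply: shift_homogeneousM (hx c) _.
  have /and3P[/eqP degc uus _] := admissible_index c.
  rewrite /res_deg degc add0n -[edeg _]addn0.
  apply: shift_homogeneous_on; apply: monomial_on_sign; apply: monomial_on_esupp.
  exact: mem_mon uus.
move=> c dc; apply: shift_homogeneousP dc _.
rewrite (res_diff_coef (x : {ffun res_index us j.+1 -> E})).
apply: shift_homogeneous_sum => b; apply: shift_homogeneousM (hx b) _.
apply: boundary_homogeneous; exact: admissible_index.
Qed.

Hypothesis proper_us : ideal us != fullv.
Hypothesis degree_us : degree_increasing us.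

(** A constant term would force the support of [g(e_t u)] to contain [t |: esupp u], so its degree
    would exceed that of [u]; but it precedes [u] in a degree increasing order. *)
Lemma step_coef0 u t : u \in us -> step_coef us t u set0 = 0.
Proof.
move=> uus; have [/andP[tq tu]|nC] := boolP ((t \in qset us u) && (t \notin esupp u)); last first.
  by rewrite /step_coef (negPf nC) ffunE.
have [wus sub _ lt_wu] := decomposition_genP mon_us uniq_us lq_us uus tq tu.
have := step_coef_monomial mon_us uniq_us lq_us uus tq tu; move=> ->.
rewrite coefZ_basis; case: eqP => // /esym/eqP; rewrite setD_eq0 => sub'.
have := subset_leq_card sub'; rewrite cardsU1 tu add1n ltnNge; case/negP.
have lt_u : (index u us < size us)%N by rewrite index_mem.
have := sorted_leq_nth leq_trans leqnn 0%N degree_us.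
move=> /(_ (index (g t u) us) (index u us)); rewrite !inE !size_map index_mem wus lt_u.
by rewrite (nth_map 0) ?index_mem // (nth_map 0) // !nth_index //; apply=> //; apply: ltnW.
Qed.

(** A constant generator would make the ideal all of E. *)
Lemma generator_coef0 u : u \in us -> u set0 = 0.
Proof.
move=> uus; apply/eqP; apply: contraNT proper_us => u0.
have su : esupp u = set0.
  apply/eqP; have := monomial_on_esupp (mem_mon mon_us uus) => uE.
  move: u0; rewrite [in u _]uE coefZ_basis [set0 == _]eq_sym.
  by case: (esupp u =P set0) => // _; rewrite eqxx.
rewrite eqEsubv subvf; apply/subvP => x _; apply/(ideal_monomialP _ mon_us) => A _.
by apply/hasP; exists u; rewrite // su sub0set.
Qed.

Lemma coefM0 x y : y set0 = 0 -> (x * y) set0 = 0.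
Proof.
move=> y0; apply/eqP; apply: contraT => /coefM_neq0[A [B [_ yB _]]] /esym/eqP.
by rewrite setU_eq0 => /andP[_ /eqP B0]; rewrite B0 y0 eqxx in yB.
Qed.

Lemma mem_maximal x : x set0 = 0 -> x \in ideal [seq gen K k | k <- enum 'I_n].
Proof.
move=> x0; have -> : enum 'I_n = enum [set: 'I_n] by rewrite enum_setT enumT.
apply/ideal_genP => A xA; rewrite -setI_eq0 setTI.
by apply: contraNneq xA => ->; rewrite x0.
Qed.

Lemma boundary_coef0 j a u (c : res_index us j) : admissible us j.+1 a u ->
  (boundary us j.+1 a u : {ffun res_index us j -> E}) c set0 = 0.
Proof.
move=> adm; have /and3P[_ uus _] := adm.
rewrite boundary_coef // sum_ffunE; apply: big1 => t _; rewrite ffunE.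
have coef_bool z (b : bool) : (z * b%:R : E) set0 = if b then z set0 else 0.
  by case: b; rewrite ?mulr1 // mulr0 ffunE.
rewrite !coef_bool step_coef0 // if_same addr0 -mulNr coefM0 ?if_same //.
by rewrite ffunE eq_sym -cards_eq0 cards1.
Qed.

Lemma res_diff_minimal i (x : res_module us i.+1) :
  in_ideal_mul (ideal [seq gen K k | k <- enum 'I_n]) (res_diff x).
Proof.
case: i x => [|j] x.
  (* Since F_0 is E, its basis is 1 and the element is its own coordinate. *)
  exists [:: (res_diff x : E, 1 : E)]; last by rewrite big_seq1; apply/esym/mulr1.
  rewrite /= andbT; apply: mem_maximal; rewrite sum_ffunE; apply: big1 => c _.
  do 2!apply: coefM0; apply: generator_coef0; exact: ssvalP.
pose dx : {ffun res_index us j -> E} := res_diff x.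
exists [seq (dx c, res_basis us j (bmnm (val c).1) (ssval (val c).2)) | c <- enum (res_index us j)].
  apply/allP => _ /mapP[c _ ->] /=; apply: mem_maximal.
  rewrite /dx (res_diff_coef (x : {ffun res_index us j.+1 -> E})) sum_ffunE.
  apply: big1 => p _; apply: coefM0; apply: boundary_coef0; exact: admissible_index.
by rewrite big_map big_enum; apply: res_basis_expand.
Qed.

End GradedMinimal.

Theorem theorem4p5 (K : fieldType) (n : nat) (I : {vspace exterior K n})
    (us : seq (exterior K n)) :
  I != fullv ->
  minimal_monomial_generators I us ->
  linear_quotients us ->
  degree_increasing us ->
  regular_decomposition us ->
  exists d : forall i, {linear res_module us i.+1 -> res_module us i},
    [/\ forall u, u \in us ->
          d 0%N (res_basis us 0 0%MM u) = (-1) ^+ edeg u * u :> exterior K n,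
        forall (j : nat) (a : 'X_{1..n}) (u : exterior K n),
          mdeg a = j.+1 -> u \in us -> expsupp a \subset qset us u ->
          d j.+1 (res_basis us j.+1 a u) =
            - (\sum_(t in expsupp a)
                 ((-1) ^+ edeg u * gen K t) *: res_basis us j (a - U_(t))%MM u)
            + \sum_(t in expsupp a :\: esupp u)
                 ((-1) ^+ edeg (decomposition us (gen K t * u))
                  * monomial_div (gen K t * u) (decomposition us (gen K t * u)))
                 *: res_basis us j (a - U_(t))%MM (decomposition us (gen K t * u))
      & graded_minimal_resolution I d].
Proof.
move=> properI [mon_us uniq_us idealI _] lq_us degree_us reg_us.
exists (fun i => @res_diff K n us i); split.
- move=> u uus; rewrite /= res_diff_basis.
  by rewrite /admissible mdeg0 uus ifT //=; apply/subsetP => k; rewrite inE mnm0E eqxx.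
- by move=> j a u dega uus suppa; rewrite /= res_diff_basis /admissible dega eqxx uus suppa.
- rewrite -idealI in properI *; split=> [x|i x|i p x|i x].
  + exact: res_diff_image.
  + exact: res_diff_exact.
  + exact: res_diff_homogeneous.
  + exact: res_diff_minimal.
Qed.
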